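(* Suppose that $f\in L^\infty(\mathbb{T})$ is real-valued. Then the following conditions are equivalent: (1) $T_f$ is positive on $H^2$; (2) $T_f$ is essentially positive on $H^2$; (3) $f(t)\in[0,\infty)$ for almost every $t\in\mathbb{T}$.
   Context: $\mathbb{T}$ is the unit circle. The Hardy space is $H^2=\{f\in L^2(\mathbb{T}): f_k=0\text{ for }k<0\}$, where $f_k$ is the $k$th Fourier coefficient of $f$. $P$ denotes the orthogonal projection of $L^2(\mathbb{T})$ onto $H^2$, and the Toeplitz operator $T_f:H^2\to H^2$ with symbol $f\in L^\infty(\mathbb{T})$ is the bounded operator $T_fg=P(fg)$; it is self-adjoint when $f$ is real-valued. A bounded operator $T$ on a Hilbert space $H$ is Fredholm if $\ker T$ and $H/T(H)$ are finite-dimensional; $\sigma_{\rm ess}(T)=\{\lambda\in\mathbb{C}:T-\lambda\text{ is not Fredholm}\}$. A bounded self-adjoint operator $T$ is positive if its spectrum $\sigma(T)\subset[0,\infty)$ (equivalently $\langle Tx,x\rangle\ge0$ for all $x$), and essentially positive if $\sigma_{\rm ess}(T)\subset[0,\infty)$. *)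

(* Defs.v *)
From HB Require Import structures.
From mathcomp Require Import all_boot all_order all_algebra.
From mathcomp Require Import generic_quotient ring_quotient.
From mathcomp Require Import complex.
From mathcomp Require Import all_classical all_reals all_analysis.
From mathcomp Require Import measurable_realfun.
From mathcomp Require Import ring lra.

Set Implicit Arguments.
Unset Strict Implicit.
Unset Printing Implicit Defensive.

Import Order.TTheory GRing.Theory Num.Theory.
Import numFieldNormedType.Exports.
Import ComplexField.Normc.

Local Open Scope classical_set_scope.
Local Open Scope complex_scope.
Local Open Scope ring_scope.

Section complex_measurable.
Context {R : realType}.

(* R[i] carries the Borel sets of the plane, transported along
   z |-> (Re z, Im z); the circle carries their traces. *)
Definition complex_pair (z : R[i]) : measurableTypeR R * measurableTypeR R :=
  (complex.Re z, complex.Im z).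

HB.instance Definition _ := isPointed.Build R[i] 0.

HB.instance Definition _ := @isMeasurable.Build default_measure_display
  R[i] (g_sigma_algebra_preimage complex_pair)
  (@measurable0 _ (g_sigma_algebra_preimageType complex_pair))
  (@measurableC _ (g_sigma_algebra_preimageType complex_pair))
  (@bigcupT_measurable _ (g_sigma_algebra_preimageType complex_pair)).

Lemma measurable_complexP d (T : measurableType d) (f : T -> R[i]) :
  measurable_fun setT f <->
  measurable_fun setT (fun x => complex.Re (f x)) /\
  measurable_fun setT (fun x => complex.Im (f x)).
Proof.
split=> [mf|[mre mim]].
  have : measurable_fun setT (complex_pair \o f).
    move=> _ B mB; rewrite setTI comp_preimage -[X in measurable X]setTI.
    by apply: mf => //; exists B => //; rewrite setTI.
  by move=> /measurable_fun_pairP[].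
move=> _ _ [B mB <-]; rewrite !setTI -comp_preimage -[X in measurable X]setTI.
have : measurable_fun setT (complex_pair \o f) by apply/measurable_fun_pairP.
exact.
Qed.

Lemma normc_sqr (z : R[i]) :
  normc z ^+ 2 = complex.Re z ^+ 2 + complex.Im z ^+ 2.
Proof. by case: z => a b /=; rewrite sqr_sqrtr // addr_ge0 ?sqr_ge0. Qed.

Lemma measurable_complexD d (T : measurableType d) (f g : T -> R[i]) :
  measurable_fun setT f -> measurable_fun setT g ->
  measurable_fun setT (fun x => f x + g x).
Proof.
move=> /measurable_complexP[f1 f2] /measurable_complexP[g1 g2].
apply/measurable_complexP; split.
  rewrite (_ : (fun _ => _) = (fun x => complex.Re (f x) + complex.Re (g x))).
    exact: measurable_funD.
  by apply/funext => x; case: (f x) => ? ?; case: (g x).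
rewrite (_ : (fun _ => _) = (fun x => complex.Im (f x) + complex.Im (g x))).
  exact: measurable_funD.
by apply/funext => x; case: (f x) => ? ?; case: (g x).
Qed.

Lemma measurable_complexM d (T : measurableType d) (f g : T -> R[i]) :
  measurable_fun setT f -> measurable_fun setT g ->
  measurable_fun setT (fun x => f x * g x).
Proof.
move=> /measurable_complexP[f1 f2] /measurable_complexP[g1 g2].
apply/measurable_complexP; split.
  rewrite (_ : (fun _ => _) = (fun x => complex.Re (f x) * complex.Re (g x) -
     complex.Im (f x) * complex.Im (g x))).
    by apply: measurable_funB; exact: measurable_funM.
  by apply/funext => x; case: (f x) => ? ?; case: (g x).
rewrite (_ : (fun _ => _) = (fun x => complex.Re (f x) * complex.Im (g x) +
     complex.Im (f x) * complex.Re (g x))).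
  by apply: measurable_funD; exact: measurable_funM.
by apply/funext => x; case: (f x) => ? ?; case: (g x).
Qed.

Lemma measurable_normc_sqr d (T : measurableType d) (f : T -> R[i]) :
  measurable_fun setT f ->
  measurable_fun setT (fun x => (normc (f x) ^+ 2)%:E).
Proof.
move=> /measurable_complexP[f1 f2]; apply/measurable_EFinP.
rewrite (_ : (fun _ => _) =
  (fun x => complex.Re (f x) ^+ 2 + complex.Im (f x) ^+ 2)).
  by apply: measurable_funD; exact: measurable_funX.
by apply/funext => x; rewrite normc_sqr.
Qed.

End complex_measurable.

Section circle.
Context {R : realType}.

Definition circle : Type := {z : R[i] | `|z| == 1}.

Lemma expi_proof (t : R) : `|cos t +i* sin t| == 1 :> R[i].
Proof. by rewrite normc_def /= cos2Dsin2 sqrtr1. Qed.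

Definition expi (t : R) : circle := exist _ (cos t +i* sin t) (expi_proof t).

HB.instance Definition _ := Choice.on circle.
HB.instance Definition _ := isPointed.Build circle (expi 0).
HB.instance Definition _ := @isMeasurable.Build default_measure_display
  circle (g_sigma_algebra_preimage (fun z : circle => \val z))
  (@measurable0 _ (g_sigma_algebra_preimageType (fun z : circle => \val z)))
  (@measurableC _ (g_sigma_algebra_preimageType (fun z : circle => \val z)))
  (@bigcupT_measurable _ (g_sigma_algebra_preimageType (fun z : circle => \val z))).

End circle.
Arguments circle : clear implicits.

Section circle_measure.
Context {R : realType}.
Implicit Types t : R.

Lemma measurable_expi : measurable_fun setT (@expi R).
Proof.
have me : measurable_fun setT (fun t => \val (expi t)).
  by apply/measurable_complexP; split; apply: continuous_measurable_fun;
    [exact: continuous_cos | exact: continuous_sin].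
move=> _ _ [B mB <-]; rewrite !setTI -comp_preimage -[X in measurable X]setTI.
exact: me.
Qed.

HB.instance Definition _ :=
  isMeasurableFun.Build _ _ _ _ (@expi R) measurable_expi.

Lemma inv2pi_ge0 : 0 <= (2 * pi)^-1 :> R.
Proof. by rewrite invr_ge0 mulr_ge0 // pi_ge0. Qed.

(* Normalized arc length: the image of dt/(2 pi) on [0, 2 pi[ under
   t |-> cos t + i sin t. *)
Definition circle_measure : set (circle R) -> \bar R :=
  pushforward
    (mscale (NngNum inv2pi_ge0)
       (mrestr lebesgue_measure (measurable_itv `[0, 2 * pi[)))
    expi.

Let circle_measure0 : circle_measure set0 = 0%E.
Proof. by rewrite /circle_measure measure0 //; exact: measurable_expi. Qed.

Let circle_measure_ge0 A : (0 <= circle_measure A)%E.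
Proof. rewrite /circle_measure measure_ge0 //; exact: measurable_expi. Qed.

Let circle_measure_sigma_additive : semi_sigma_additive circle_measure.
Proof.
by apply: measure_semi_sigma_additive; exact: measurable_expi.
Qed.

HB.instance Definition _ := isMeasure.Build _ _ _ circle_measure
  circle_measure0 circle_measure_ge0 circle_measure_sigma_additive.

Lemma circle_measure_setT : circle_measure setT = 1%E.
Proof.
rewrite /circle_measure /pushforward preimage_setT /mscale /= /mrestr setTI.
rewrite lebesgue_measure_itv /= lte_fin mulr_gt0 ?pi_gt0 // sube0.
by rewrite -EFinM mulVf // gt_eqF // mulr_gt0 ?pi_gt0.
Qed.

HB.instance Definition _ :=
  Measure_isProbability.Build _ _ _ circle_measure circle_measure_setT.

End circle_measure.
Arguments circle_measure : clear implicits.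

Section complex_integral.
Context d (T : measurableType d) (R : realType).
Variable mu : {measure set T -> \bar R}.
Implicit Types f g : T -> R[i].

Definition cint f : R[i] :=
  (\int[mu]_x complex.Re (f x)) +i* (\int[mu]_x complex.Im (f x)).

End complex_integral.

Section square_integrable.
Context d (T : measurableType d) (R : realType).
Variable mu : {measure set T -> \bar R}.
Implicit Types f g e : T -> R[i].

Definition sqint : {pred T -> R[i]} := mem [set f |
  measurable_fun setT f /\ (\int[mu]_x (normc (f x) ^+ 2)%:E < +oo)%E].

Lemma sqintP f : f \in sqint <->
  measurable_fun setT f /\ (\int[mu]_x (normc (f x) ^+ 2)%:E < +oo)%E.
Proof. by split=> [/set_mem|/mem_set]. Qed.

Lemma sqint_submod_closed : submod_closed sqint.
Proof.
split=> [|a f g /sqintP[mf if2] /sqintP[mg ig2]]; apply/sqintP.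
  split; first exact: measurable_cst.
  by rewrite integral0_eq // => x _; rewrite normc0 expr0n.
have maf : measurable_fun setT (fun x => a * f x + g x).
  apply: measurable_complexD => //.
  by apply: measurable_complexM => //; exact: measurable_cst.
split=> //; set A : R := 2 * normc a ^+ 2.
have A0 : 0 <= A by rewrite mulr_ge0 // sqr_ge0.
apply: (@le_lt_trans _ _ (\int[mu]_x (A%:E * (normc (f x) ^+ 2)%:E +
    2%:E * (normc (g x) ^+ 2)%:E))%E).
  apply: ge0_le_integral => //.
  - by move=> x _; rewrite lee_fin sqr_ge0.
  - exact: measurable_normc_sqr.
  - by apply: emeasurable_funD; apply: measurable_funeM;
      exact: measurable_normc_sqr.
  - move=> x _; rewrite -!EFinM -EFinD lee_fin /A !normc_sqr.
    rewrite [(_ *: _ + _) x]/(a * f x + g x).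
    case: a {maf A A0} (f x) (g x) => [a b] [c e] [u v] /=.
    rewrite -subr_ge0 (_ : _ - _ = (a * c - b * e - u) ^+ 2 +
      (a * e + b * c - v) ^+ 2); first by rewrite addr_ge0 ?sqr_ge0.
    by ring.
rewrite ge0_integralD //; last 4 first.
- by move=> x _; rewrite mule_ge0 ?lee_fin ?sqr_ge0.
- by apply: measurable_funeM; exact: measurable_normc_sqr.
- by move=> x _; rewrite mule_ge0 ?lee_fin ?sqr_ge0.
- by apply: measurable_funeM; exact: measurable_normc_sqr.
rewrite !ge0_integralZl_EFin //; last 4 first.
- by move=> x _; rewrite lee_fin sqr_ge0.
- exact: measurable_normc_sqr.
- by move=> x _; rewrite lee_fin sqr_ge0.
- exact: measurable_normc_sqr.
by rewrite lte_add_pinfty // lte_mul_pinfty ?lee_fin.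
Qed.

HB.instance Definition _ :=
  GRing.isSubmodClosed.Build R[i] (T -> R[i]) sqint sqint_submod_closed.

Lemma sqint_mul_integrable f e : f \in sqint -> e \in sqint ->
  mu.-integrable setT (EFin \o (fun x => complex.Re (f x * e x))) /\
  mu.-integrable setT (EFin \o (fun x => complex.Im (f x * e x))).
Proof.
move=> /sqintP[mf if2] /sqintP[me ie2].
have dom : mu.-integrable setT
    (fun x => (normc (f x) ^+ 2)%:E + (normc (e x) ^+ 2)%:E)%E.
  by apply: integrableD => //; apply/integrableP; split;
    (try exact: measurable_normc_sqr);
    under eq_integral do rewrite gee0_abs ?lee_fin ?sqr_ge0 //.
have /measurable_complexP[m1 m2] := measurable_complexM mf me.
have bound (x y : R[i]) :
    `|complex.Re (x * y)| <= normc x ^+ 2 + normc y ^+ 2 /\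
    `|complex.Im (x * y)| <= normc x ^+ 2 + normc y ^+ 2.
  rewrite !normc_sqr; case: x y => [a b] [c h] /=.
  have := (sqr_ge0 (a + c), sqr_ge0 (a - c), sqr_ge0 (b + h), sqr_ge0 (b - h)).
  have := (sqr_ge0 (a + h), sqr_ge0 (a - h), sqr_ge0 (b + c), sqr_ge0 (b - c)).
  have := (sqr_ge0 a, sqr_ge0 b, sqr_ge0 c, sqr_ge0 h).
  move=> [[[? ?] ?] ?] [[[? ?] ?] ?] [[[? ?] ?] ?].
  by rewrite !ler_norml; split; apply/andP; split; nra.
split; apply: le_integrable dom => //; do ?exact/measurable_EFinP.
  by move=> x _ /=; rewrite lee_fin (le_trans (bound _ _).1) // ler_norm.
by move=> x _ /=; rewrite lee_fin (le_trans (bound _ _).2) // ler_norm.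
Qed.

Let RintegralL3 (a b : R) (u v w : T -> R) :
  mu.-integrable setT (EFin \o u) -> mu.-integrable setT (EFin \o v) ->
  mu.-integrable setT (EFin \o w) ->
  \int[mu]_x (a * u x + b * v x + w x) =
  a * (\int[mu]_x u x) + b * (\int[mu]_x v x) + \int[mu]_x w x.
Proof.
move=> iu iv iw.
have iau : mu.-integrable setT (EFin \o (fun x => a * u x)).
  exact: (integrableZl measurableT a iu).
have ibv : mu.-integrable setT (EFin \o (fun x => b * v x)).
  exact: (integrableZl measurableT b iv).
have iD : mu.-integrable setT (EFin \o (fun x => a * u x + b * v x)).
  exact: (integrableD measurableT iau ibv).
by rewrite RintegralD // RintegralD // !RintegralZl.
Qed.

Lemma cint_mul_linear a f g e : f \in sqint -> g \in sqint -> e \in sqint ->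
  cint mu (fun x => (a * f x + g x) * e x) =
  a * cint mu (fun x => f x * e x) + cint mu (fun x => g x * e x).
Proof.
move=> sf sg se.
have [f1 f2] := sqint_mul_integrable sf se.
have [g1 g2] := sqint_mul_integrable sg se.
rewrite /cint; case: a => a b.
rewrite (_ : (fun x => complex.Re _) = (fun x => a * complex.Re (f x * e x) +
    (- b) * complex.Im (f x * e x) + complex.Re (g x * e x))); last first.
  by apply/funext => x; case: (f x) (g x) (e x) => [? ?] [? ?] [? ?] /=; ring.
rewrite (_ : (fun x => complex.Im ((_ + g x) * _)) =
    (fun x => a * complex.Im (f x * e x) +
     b * complex.Re (f x * e x) + complex.Im (g x * e x))); last first.
  by apply/funext => x; case: (f x) (g x) (e x) => [? ?] [? ?] [? ?] /=; ring.
rewrite !RintegralL3 //.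
by apply/eqP; rewrite eq_complex /=; apply/andP; split; apply/eqP; ring.
Qed.

Lemma eq_cint_mul_ae f g e : f \in sqint -> g \in sqint -> e \in sqint ->
  {ae mu, forall x, f x = g x} ->
  cint mu (fun x => f x * e x) = cint mu (fun x => g x * e x).
Proof.
move=> sf sg se fg.
have [f1 f2] := sqint_mul_integrable sf se.
have [g1 g2] := sqint_mul_integrable sg se.
rewrite /cint /Rintegral; congr (fine _ +i* fine _); apply: ae_eq_integral => //.
- exact: measurable_int f1.
- exact: measurable_int g1.
- by apply: filterS fg => x /= ->.
- exact: measurable_int f2.
- exact: measurable_int g2.
- by apply: filterS fg => x /= ->.
Qed.

End square_integrable.


Section L2.
Context d (T : measurableType d) (R : realType).
Variable mu : {measure set T -> \bar R}.
Implicit Types f g : T -> R[i].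
Local Open Scope quotient_scope.

Definition sqint_fun : Type := {f : T -> R[i] | f \in sqint mu}.
HB.instance Definition _ := SubChoice.on sqint_fun.
HB.instance Definition _ := [SubChoice_isSubLmodule of sqint_fun by <:].

Lemma sqint_fun_linE a (f g : sqint_fun) t :
  \val (a *: f + g) t = a * \val f t + \val g t.
Proof. by rewrite linearP. Qed.

Lemma sqint_fun_scaleE a (f : sqint_fun) t : \val (a *: f) t = a * \val f t.
Proof. by rewrite linearZ. Qed.

Lemma sqint_fun_subE (f g : sqint_fun) t : \val (f - g) t = \val f t - \val g t.
Proof. by rewrite raddfB. Qed.

(* L2 mu is the quotient of the square-integrable functions by the submodule of
   those vanishing almost everywhere; an element coerces to one of its
   representatives. *)
Definition null_fun : {pred sqint_fun} :=
  mem [set f | {ae mu, forall t, \val f t = 0}].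

Lemma null_submod_closed : submod_closed null_fun.
Proof.
split=> [|a f g /set_mem f0 /set_mem g0]; apply/mem_set; first exact: aeW.
apply: filterS2 f0 g0 => t ft gt.
by rewrite sqint_fun_linE ft gt mulr0 addr0.
Qed.

HB.instance Definition _ :=
  GRing.isSubmodClosed.Build R[i] sqint_fun null_fun null_submod_closed.

Definition L2 : Type := Quotient.quot null_fun.
HB.instance Definition _ := GRing.Zmodule.on L2.
HB.instance Definition _ :=
  @EqQuotient.on (Quotient.quot null_fun).

Definition L2_class (f : sqint_fun) : L2 := \pi_(Quotient.quot null_fun) f.

Definition L2_repr (x : L2) : sqint_fun := repr (x : Quotient.quot null_fun).

Definition L2_fun (x : L2) : T -> R[i] := \val (L2_repr x).
Coercion L2_fun : L2 >-> Funclass.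

Lemma L2_reprK x : L2_class (L2_repr x) = x.
Proof. exact: reprK. Qed.

Lemma L2_class_eq (f g : sqint_fun) :
  L2_class f = L2_class g <-> {ae mu, forall t, \val f t = \val g t}.
Proof.
rewrite (rwP eqP) -Quotient.idealrBE; split=> [/set_mem|fg].
  by apply: filterS => t /eqP; rewrite sqint_fun_subE subr_eq0 => /eqP.
apply/mem_set; apply: filterS fg => t fg.
by rewrite sqint_fun_subE fg subrr.
Qed.

Lemma L2_classK (f : sqint_fun) :
  {ae mu, forall t, L2_class f t = \val f t}.
Proof. by apply/L2_class_eq; rewrite L2_reprK. Qed.

Lemma L2_classD (f g : sqint_fun) : L2_class (f + g) = L2_class f + L2_class g.
Proof. exact: raddfD. Qed.

Definition L2_scale (a : R[i]) (x : L2) : L2 := L2_class (a *: L2_repr x).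

Lemma L2_scale_class a (f : sqint_fun) : L2_scale a (L2_class f) = L2_class (a *: f).
Proof.
apply/L2_class_eq; apply: filterS (L2_classK f) => t ft.
by rewrite !sqint_fun_scaleE -[\val (L2_repr _) t]/(L2_class f t) ft.
Qed.

Lemma L2_scaleA a b x : L2_scale a (L2_scale b x) = L2_scale (a * b) x.
Proof. by rewrite -[x]L2_reprK !L2_scale_class scalerA. Qed.

Lemma L2_scale1 : left_id 1 L2_scale.
Proof. by move=> x; rewrite -[x]L2_reprK !L2_scale_class scale1r. Qed.

Lemma L2_scaleDr : right_distributive L2_scale +%R.
Proof.
move=> a x y; rewrite -[x]L2_reprK -[y]L2_reprK.
by rewrite !(L2_scale_class, =^~ L2_classD) scalerDr.
Qed.

Lemma L2_scaleDl x : {morph L2_scale^~ x : a b / a + b}.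
Proof.
move=> a b; rewrite -[x]L2_reprK.
by rewrite !(L2_scale_class, =^~ L2_classD) scalerDl.
Qed.

HB.instance Definition _ := GRing.Zmodule_isLmodule.Build R[i] L2
  L2_scaleA L2_scale1 L2_scaleDr L2_scaleDl.

Lemma L2_lin_ae a (x y : L2) :
  {ae mu, forall t, (a *: x + y : L2) t = a * x t + y t}.
Proof.
have -> : a *: x + y = L2_class (a *: L2_repr x + L2_repr y).
  by rewrite L2_classD L2_reprK.
by apply: filterS (L2_classK (a *: L2_repr x + L2_repr y)) => t ->;
  rewrite sqint_fun_linE.
Qed.

Lemma L2_sqint (x : L2) : (x : T -> R[i]) \in sqint mu.
Proof. exact: valP. Qed.

Definition inner (x y : L2) : R[i] := cint mu (fun t => x t * (y t)^*).

Definition L2_norm (x : L2) : R := Num.sqrt (\int[mu]_t normc (x t) ^+ 2).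

End L2.

Section Linfty.
Context d (T : measurableType d) (R : realType).
Variable mu : {measure set T -> \bar R}.

(* A representative of an element of L^oo: two a.e. equal representatives
   multiply classes of L2 in the same way. *)
Record Linfty : Type := MkLinfty {
  Linfty_fun :> T -> R[i];
  Linfty_measurable : measurable_fun setT Linfty_fun;
  Linfty_bounded : exists M : R, {ae mu, forall t, normc (Linfty_fun t) <= M}
}.

Lemma Linfty_mul_sqint (f : Linfty) (g : sqint_fun mu) :
  (fun t => f t * \val g t) \in sqint mu.
Proof.
have /sqintP[mg ig] := valP g; apply/sqintP.
have mfg := measurable_complexM (Linfty_measurable f) mg.
split=> //; have [M fM] := Linfty_bounded f.
apply: (@le_lt_trans _ _
  (\int[mu]_t ((M ^+ 2)%:E * (normc (\val g t) ^+ 2)%:E))%E).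
  apply: ae_ge0_le_integral => //.
  - by move=> t _; rewrite lee_fin sqr_ge0.
  - exact: measurable_normc_sqr.
  - by move=> t _; rewrite mule_ge0 ?lee_fin ?sqr_ge0.
  - by apply: measurable_funeM; exact: measurable_normc_sqr.
  apply: filterS fM => t ftM _.
  rewrite -EFinM lee_fin normcM exprMn ler_wpM2r ?sqr_ge0 // lerXn2r ?nnegrE //.
    by case: (f t) => a b /=; exact: sqrtr_ge0.
  by apply: le_trans ftM; case: (f t) => a b /=; exact: sqrtr_ge0.
rewrite ge0_integralZl_EFin ?sqr_ge0 //.
- by rewrite lte_mul_pinfty ?lee_fin ?sqr_ge0.
- by move=> t _; rewrite lee_fin sqr_ge0.
- exact: measurable_normc_sqr.
Qed.

Definition L2_mul (f : Linfty) (x : L2 mu) : L2 mu :=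
  L2_class (exist _ (fun t => f t * x t) (Linfty_mul_sqint f (L2_repr x))).

End Linfty.

Section operators.
Context {R : realType} {V : lmodType R[i]}.
Implicit Types (S : set V) (A B : V -> V) (l : R[i]).

(* For a linear subspace S: S, resp. the quotient V / S, is finite-dimensional,
   i.e. finitely many vectors span it. *)
Definition finite_dim S := exists n (v : 'I_n -> V),
  forall x, S x -> exists c : 'I_n -> R[i], x = \sum_(i < n) c i *: v i.

Definition finite_codim S := exists n (v : 'I_n -> V),
  forall x, exists c : 'I_n -> R[i], S (x - \sum_(i < n) c i *: v i).

(* The notions below are meant for bounded linear operators A (self-adjoint ones
   for positivity). *)
Definition fredholm A := finite_dim [set x | A x = 0] /\ finite_codim (range A).

Definition shift_op A l : V -> V := fun x => A x - l *: x.

Definition ess_spectrum A : set R[i] := [set l | ~ fredholm (shift_op A l)].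

Variable nrm : V -> R.

Definition bounded_op A := exists M : R, forall x, nrm (A x) <= M * nrm x.

(* shift_op A l must have a two-sided inverse which is bounded for nrm. *)
Definition spectrum A : set R[i] :=
  [set l | ~ exists B, [/\ bounded_op B, cancel (shift_op A l) B
                         & cancel B (shift_op A l)]].

(* In the order of R[i], 0 <= l means Im l = 0 and 0 <= Re l. *)
Definition positive_op A := spectrum A `<=` [set l | 0 <= l].

Definition ess_positive_op A := ess_spectrum A `<=` [set l | 0 <= l].

End operators.

Section Hardy.
Context {R : realType}.
Local Notation sigma := (circle_measure R).

Definition fourier (x : L2 sigma) (k : int) : R[i] :=
  cint sigma (fun z => x z * \val z ^ (- k)).

Definition hardy : {pred L2 sigma} :=
  mem [set x | forall k : int, k < 0 -> fourier x k = 0].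

Lemma sqint_zpow (n : nat) : (fun z : circle R => \val z ^+ n) \in sqint sigma.
Proof.
have mval : measurable_fun setT (fun z : circle R => \val z).
  by move=> _ B mB; exists B.
apply/sqintP; split.
  elim: n => [|n IH]; first exact: measurable_cst.
  rewrite (_ : (fun _ => _) = (fun z : circle R => \val z * \val z ^+ n)).
    exact: measurable_complexM.
  by apply/funext => z; rewrite exprS.
rewrite (_ : (fun _ => _) = cst 1%E).
  by rewrite integral_cst //= mul1e probability_setT ltry.
apply/funext => z; congr EFin.
have z1 : normc (\val z) = 1.
  by have /eqP := valP z; rewrite normc_def; case: (\val z) => a b [].
suff -> : normc (\val z ^+ n) = 1 by rewrite expr1n.
by elim: n => [|n IH]; [exact: normc1 | rewrite exprS normcM z1 mul1r].
Qed.

Lemma fourier_linear (k : int) a (x y : L2 sigma) : k < 0 ->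
  fourier (a *: x + y) k = a * fourier x k + fourier y k.
Proof.
case: k => // n _; have se := sqint_zpow n.+1.
rewrite /fourier (_ : - Negz n = n.+1 :> int); last by rewrite NegzE opprK.
rewrite -cint_mul_linear ?L2_sqint //.
apply: eq_cint_mul_ae => //; first exact: L2_sqint.
  exact: (rpredD (rpredZ a (L2_sqint x)) (L2_sqint y)).
exact: L2_lin_ae.
Qed.

Lemma hardy_submod_closed : submod_closed hardy.
Proof.
split=> [|a x y /set_mem hx /set_mem hy]; apply/mem_set => k k0.
  have := fourier_linear (-1) 0 0 k0.
  by rewrite scaler0 addr0 mulN1r addNr.
by rewrite fourier_linear // hx // hy // mulr0 addr0.
Qed.

HB.instance Definition _ :=
  GRing.isSubmodClosed.Build R[i] (L2 sigma) hardy hardy_submod_closed.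

Definition H2 : Type := {x : L2 sigma | x \in hardy}.
HB.instance Definition _ := SubChoice.on H2.
HB.instance Definition _ := [SubChoice_isSubLmodule of H2 by <:].

Definition H2_norm (g : H2) : R := L2_norm (\val g).

(* The orthogonal projection onto H2: H2_proj x is the p in H2 such that x - p is
   orthogonal to H2. It is unique, and exists because H2 is closed in the
   complete space L2; the default value 0 of xget is never used. *)
Definition H2_proj (x : L2 sigma) : H2 :=
  xget 0 [set p : H2 | forall g : H2, inner (x - \val p) (\val g) = 0].

Definition toeplitz (f : Linfty sigma) (g : H2) : H2 :=
  H2_proj (L2_mul f (\val g)).

End Hardy.
Arguments H2 : clear implicits.

(* Main.v *)
Require Import Defs.
From mathcomp Require Import all_boot all_order all_algebra.
From mathcomp Require Import complex.
From mathcomp Require Import all_classical all_reals all_analysis.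
From mathcomp Require Import measurable_realfun ess_sup_inf.
From mathcomp Require Import ring lra.

(** Positivity implies essential positivity because an invertible operator is
Fredholm, so that the essential spectrum lies in the spectrum
([positive_op_ess_positive]). The cycle is closed by two more implications.

If f is nonnegative, then T_f is positive: the form <T_f g, g> is the integral of
f |g|^2, hence nonnegative. For l outside [0, +oo[ the form of T_f - l, multiplied
by a suitable scalar, is therefore coercive, and T_f - l is boundedly invertible by
the Lax-Milgram theorem ([lax_milgram], [nonneg_form_positive_op]).

If T_f is essentially positive, then f is nonnegative. Suppose that the essential
infimum l of f is negative, and let A be T_f - l, the Toeplitz operator with symbol
f - l. The range of A has infinite codimension, so l is a negative point of the
essential spectrum. Indeed, the set E on which |f - l| is at most a given eps has
positive measure. The functions z^k 1_E have the same norm for all k, and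
multiplication by f - l makes them small. As k grows they tend weakly to zero, and
their distance from the Hardy space tends to zero, because its square is at most a
tail of the sum of the squared Fourier coefficients of 1_E, which converges by the
inequality of Bessel. Their projections w to the Hardy space thus give vectors with
A w small compared to w and nearly orthogonal to any finite family
([almost_null_vector]). On the other hand, A is symmetric. If finitely many vectors
v_i together with the range of A spanned the space, then a sequence of such vectors,
blown up to unbounded norm while A w and all <v_i, w> stay bounded, would have
bounded scalar products with every vector, against the uniform boundedness principle
([uniform_boundedness], [finite_codim_bounded_below]).

The completeness of the space of square-integrable classes ([L2_complete]) enters
three times: in the projection onto the Hardy space, which subtracts the series of
negative Fourier modes ([fourier_sum], [H2_proj_residual]), in the Lax-Milgram
theorem and in the uniform boundedness principle. *)

Set Implicit Arguments.
Unset Strict Implicit.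
Unset Printing Implicit Defensive.

Import Order.TTheory GRing.Theory Num.Theory.
Import numFieldNormedType.Exports.
Import ComplexField.Normc.
Local Open Scope classical_set_scope.
Local Open Scope complex_scope.
Local Open Scope ring_scope.

(** * Complex moduli *)

Section complex_facts.
Context {R : realType}.
Implicit Types (z w : R[i]) (a : R).

Lemma normc_ge0 z : 0 <= normc z.
Proof. by case: z => a b; exact: sqrtr_ge0. Qed.

Lemma normc_conj z : normc z^*%C = normc z.
Proof. by case: z => a b /=; rewrite sqrrN. Qed.

Lemma normc_real a : normc a%:C = `|a|.
Proof. by rewrite /= expr0n addr0 sqrtr_sqr. Qed.

Lemma normc_ge_Re_norm z : `|complex.Re z| <= normc z.
Proof.
by case: z => a b /=; rewrite -sqrtr_sqr ler_wsqrtr // lerDl sqr_ge0.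
Qed.

Lemma normc_ge_Im_norm z : `|complex.Im z| <= normc z.
Proof.
by case: z => a b /=; rewrite -sqrtr_sqr ler_wsqrtr // lerDr sqr_ge0.
Qed.

Lemma conjcM z w : (z * w)^*%C = z^*%C * w^*%C.
Proof. exact: rmorphM. Qed.

Lemma conjcD z w : (z + w)^*%C = z^*%C + w^*%C.
Proof. exact: rmorphD. Qed.

Lemma mulc_conj z : z * z^*%C = (normc z ^+ 2)%:C.
Proof.
by rewrite normc_sqr; case: z => a b; congr (_ +i* _) => /=; ring.
Qed.

End complex_facts.

(** * Complete hermitian forms *)

Section hermitian.
Context {R : realType} {V : lmodType R[i]}.
Implicit Types (ip : V -> V -> R[i]) (x y z : V) (u : nat -> V).

Definition ip_norm ip x : R := Num.sqrt (complex.Re (ip x x)).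

Definition cauchy_for (N : V -> R) u := forall e, 0 < e ->
  exists n0, forall m n, (n0 <= n)%N -> (n <= m)%N -> N (u m - u n) <= e.

Definition converges_for (N : V -> R) u x := forall e, 0 < e ->
  exists n0, forall n, (n0 <= n)%N -> N (u n - x) <= e.

(** Hilbert space structures are kept as a property of a form on a bare module,
so that the same lemmas serve the space of square-integrable classes and its
Hardy subspace. *)
Record hilbert ip : Prop := Hilbert {
  ip_linear : forall a x y z, ip (a *: x + y) z = a * ip x z + ip y z;
  ip_conj : forall x y, ip y x = (ip x y)^*%C;
  ip_ge0 : forall x, 0 <= ip x x;
  ip_definite : forall x, ip x x = 0 -> x = 0;
  ip_complete : forall u, cauchy_for (ip_norm ip) u ->
    exists x, converges_for (ip_norm ip) u x
}.

Variables (ip : V -> V -> R[i]) (hip : hilbert ip).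
Local Notation N := (ip_norm ip).

Lemma ipDl x y z : ip (x + y) z = ip x z + ip y z.
Proof. by rewrite -[x]scale1r (ip_linear hip) mul1r scale1r. Qed.

Lemma ip0l z : ip 0 z = 0.
Proof. by apply: (addrI (ip 0 z)); rewrite -ipDl !addr0. Qed.

Lemma ipZl a x z : ip (a *: x) z = a * ip x z.
Proof. by rewrite -[a *: x]addr0 (ip_linear hip) ip0l addr0. Qed.

Lemma ipNl x z : ip (- x) z = - ip x z.
Proof. by rewrite -scaleN1r ipZl mulN1r. Qed.

Lemma ipBl x y z : ip (x - y) z = ip x z - ip y z.
Proof. by rewrite ipDl ipNl. Qed.

Lemma ip_suml n (F : 'I_n -> V) z :
  ip (\sum_(i < n) F i) z = \sum_(i < n) ip (F i) z.
Proof. by elim/big_ind2: _ => // [|? ? ? ? <- <-]; [exact: ip0l | exact: ipDl]. Qed.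

Lemma ipZr a x z : ip x (a *: z) = a^*%C * ip x z.
Proof. by rewrite (ip_conj hip) ipZl conjcM -(ip_conj hip). Qed.

Lemma ipDr x y z : ip x (y + z) = ip x y + ip x z.
Proof. by rewrite (ip_conj hip) ipDl conjcD -!(ip_conj hip). Qed.

Lemma ipNr x z : ip x (- z) = - ip x z.
Proof. by rewrite -scaleN1r ipZr rmorphN rmorph1 mulN1r. Qed.

Lemma ipBr x y z : ip x (y - z) = ip x y - ip x z.
Proof. by rewrite ipDr ipNr. Qed.

Lemma ip_xx x : ip x x = (N x ^+ 2)%:C.
Proof.
have := ip_ge0 hip x; rewrite /ip_norm; case: (ip x x) => a b.
by rewrite lecE /= => /andP[/eqP -> a0]; rewrite sqr_sqrtr.
Qed.

Lemma ip_norm_ge0 x : 0 <= N x. Proof. exact: sqrtr_ge0. Qed.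

Lemma ip_norm0 : N 0 = 0.
Proof. by rewrite /ip_norm ip0l sqrtr0. Qed.

Lemma ip_norm_eq0 x : N x = 0 -> x = 0.
Proof. by move=> x0; apply: (ip_definite hip); rewrite ip_xx x0 expr0n. Qed.

Lemma ip_normZ a x : N (a *: x) = normc a * N x.
Proof.
apply: (@pexpIrn _ 2) => //; rewrite ?nnegrE ?mulr_ge0 ?normc_ge0 ?ip_norm_ge0 //.
apply: complexI; rewrite -ip_xx ipZl ipZr mulrA mulc_conj ip_xx -rmorphM.
by rewrite -exprMn.
Qed.

Lemma ip_normN x : N (- x) = N x.
Proof. by rewrite /ip_norm ipNl ipNr opprK. Qed.

Lemma ip_norm_subC x y : N (x - y) = N (y - x).
Proof. by rewrite -ip_normN opprB. Qed.

Lemma ip_norm_sqB x y :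
  N (x - y) ^+ 2 = N x ^+ 2 - 2 * complex.Re (ip x y) + N y ^+ 2.
Proof.
apply: complexI; rewrite -ip_xx ipBl !ipBr !ip_xx (ip_conj hip x y).
by case: (ip x y) => a b; congr (_ +i* _) => /=; ring.
Qed.

(** Expand the norm of x minus its component along y. *)
Lemma cauchy_schwarz x y : normc (ip x y) <= N x * N y.
Proof.
have [y0|y0] := eqVneq (N y) 0.
  by rewrite (ip_norm_eq0 y0) (ip_conj hip) ip0l conjc0 normc0 ip_norm0 mulr0.
have yp : 0 < N y by rewrite lt_def y0 ip_norm_ge0.
set c := ip x y; pose b : R[i] := c / (N y ^+ 2)%:C.
have : 0 <= N (x - b *: y) ^+ 2 by exact: sqr_ge0.
have -> : N (x - b *: y) ^+ 2 = N x ^+ 2 - (normc c / N y) ^+ 2.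
  rewrite ip_norm_sqB ipZr -/c ip_normZ.
  have -> : complex.Re (b^*%C * c) = normc c ^+ 2 / N y ^+ 2.
    rewrite /b -fmorphV conjcM conjc_real mulrAC [_ * c]mulrC mulc_conj.
    by rewrite -rmorphM.
  rewrite /b normcM normcV normc_real ger0_norm ?sqr_ge0 //.
  by field.
rewrite subr_ge0 => h; rewrite -ler_pdivrMr //.
by rewrite -(@ler_pXn2r _ 2) // nnegrE ?divr_ge0 ?normc_ge0 ?ip_norm_ge0.
Qed.

Lemma ip_normD x y : N (x + y) <= N x + N y.
Proof.
rewrite -(@ler_pXn2r _ 2) ?nnegrE ?addr_ge0 ?ip_norm_ge0 //.
rewrite -{1}[y]opprK ip_norm_sqB ip_normN ipNr.
have := le_trans (normc_ge_Re_norm _) (cauchy_schwarz x y).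
case: (ip x y) => a b /=; rewrite ler_norml => /andP[_ h].
by rewrite sqrrD -mulr_natl; lra.
Qed.

Lemma ip_normB x y : N (x - y) <= N x + N y.
Proof. by rewrite -(ip_normN y) ip_normD. Qed.

Lemma ip_norm_distD z x y : N (x - y) <= N (x - z) + N (z - y).
Proof. by apply: le_trans (ip_normD _ _); rewrite addrA subrK. Qed.

Lemma converges_eq0 u x (r c : R) : 0 <= r -> 0 <= c ->
  converges_for N u x -> (exists n0, forall n, (n0 <= n)%N -> r <= c * N (u n - x)) ->
  r = 0.
Proof.
move=> r0 c0 ux [n0 rc]; apply/eqP; rewrite eq_le r0 andbT.
apply/ler_addgt0Pr => e e0; rewrite add0r.
have [n1 h] := ux (e / (c + 1)) (divr_gt0 e0 (ltr_wpDl c0 ltr01)).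
have [a b] := (rc _ (leq_maxl n0 n1), h _ (leq_maxr n0 n1)).
apply: (le_trans a); apply: (le_trans (ler_wpM2l c0 b)).
have c1 : 0 < c + 1 by lra.
by rewrite mulrCA ler_piMr ?(ltW e0) // ler_pdivrMr // mul1r lerDl.
Qed.

Lemma converges_ip0 u x y : converges_for N u x ->
  (exists n0, forall n, (n0 <= n)%N -> ip (u n) y = 0) -> ip x y = 0.
Proof.
move=> ux [n0 u0]; apply: eq0_normc.
apply: (converges_eq0 (normc_ge0 _) (ip_norm_ge0 y) ux).
exists n0 => n nn; apply: le_trans (cauchy_schwarz y (u n - x)).
by rewrite (ip_conj hip (_ - _)) normc_conj ipBl u0 // sub0r normcN.
Qed.

Lemma converges_norm_le u x b : converges_for N u x ->
  (forall n, N (u n) <= b) -> N x <= b.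
Proof.
move=> ux ub; apply/ler_addgt0Pr => e e0; have [n h] := ux e e0.
have := ip_normB (u n) (u n - x); rewrite subKr => /le_trans; apply.
by rewrite lerD ?h.
Qed.

(** * Orthonormal sequences *)

Variable e : nat -> V.
Hypothesis orthonormal : forall i j, ip (e i) (e j) = (i == j)%:R.

Let coef x k := ip x (e k).
Let psum x n := \sum_(k < n) coef x k *: e k.

Lemma psum_coef x n k : ip (psum x n) (e k) = if (k < n)%N then coef x k else 0.
Proof.
rewrite ip_suml; under eq_bigr do rewrite ipZl orthonormal mulr_natr mulrb.
rewrite -big_mkcond /=; case: ltnP => [kn|nk].
  by rewrite (big_pred1 (Ordinal kn)).
by rewrite big_pred0 // => i; apply/negbTE; rewrite neq_ltn (leq_trans (ltn_ord i)).
Qed.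

Let qsum x n : R := \sum_(k < n) normc (coef x k) ^+ 2.

Lemma ip_psumr y x n :
  ip y (psum x n) = \sum_(k < n) (coef x k)^*%C * coef y k.
Proof.
rewrite (ip_conj hip) ip_suml rmorph_sum /=; apply: eq_bigr => k _.
by rewrite ipZl conjcM -(ip_conj hip).
Qed.

Lemma ip_psum_psum x m n : (n <= m)%N ->
  ip (psum x m) (psum x n) = (qsum x n)%:C.
Proof.
move=> nm; rewrite ip_psumr /qsum rmorph_sum /=; apply: eq_bigr => k _.
by rewrite /coef psum_coef (leq_trans (ltn_ord k) nm) mulrC mulc_conj.
Qed.

Lemma ip_psum x n : ip x (psum x n) = (qsum x n)%:C.
Proof.
rewrite ip_psumr /qsum rmorph_sum /=; apply: eq_bigr => k _.
by rewrite mulrC mulc_conj.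
Qed.

Lemma sqnorm_psum x n : N (psum x n) ^+ 2 = qsum x n.
Proof. by apply: complexI; rewrite -ip_xx ip_psum_psum. Qed.

Lemma bessel x n : qsum x n <= N x ^+ 2.
Proof.
have := sqr_ge0 (N (x - psum x n)).
by rewrite ip_norm_sqB ip_psum sqnorm_psum /=; lra.
Qed.

Lemma sqnorm_psum_sub x m n : (n <= m)%N ->
  N (psum x m - psum x n) ^+ 2 = qsum x m - qsum x n.
Proof.
by move=> nm; rewrite ip_norm_sqB ip_psum_psum // !sqnorm_psum /=; lra.
Qed.

(** The partial sums of the squared coefficients increase and stay below the squared
norm, hence approach their supremum. *)
Lemma qsum_cauchy x eps : 0 < eps ->
  exists n0, forall m n, (n0 <= n)%N -> (n <= m)%N -> qsum x m - qsum x n <= eps.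
Proof.
move=> e0; pose S := [set qsum x n | n in setT].
have supS : has_sup S.
  split; first by exists (qsum x 0), 0%N.
  by exists (N x ^+ 2) => _ [n _ <-]; exact: bessel.
have [_ [n0 _ <-] h] := sup_adherent e0 supS.
have mono m n : (n <= m)%N -> qsum x n <= qsum x m.
  by move=> nm; rewrite -subr_ge0 -sqnorm_psum_sub // sqr_ge0.
exists n0 => m n n0n nm.
have : qsum x m <= sup S by apply: sup_upper_bound => //; exists m.
by have := mono _ _ n0n; lra.
Qed.

(** The coefficients tend to zero because their squares are summable. *)
Lemma coef_small x eps : 0 < eps ->
  exists n0, forall n, (n0 <= n)%N -> normc (coef x n) <= eps.
Proof.
move=> e0; have [n0 h] := qsum_cauchy x (exprn_gt0 2 e0).
exists n0 => n n0n; have := h n.+1 n n0n (leqnSn n).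
rewrite /qsum big_ord_recr /= addrAC subrr add0r.
by rewrite ler_pXn2r // nnegrE ?normc_ge0 ?ltW.
Qed.

(** The orthogonal projection onto the orthogonal complement of the sequence is
obtained by subtracting the sum of the Fourier series, which converges by
completeness. *)
Lemma fourier_sum x : exists s, [/\ forall k, ip (x - s) (e k) = 0,
  forall y, (forall k, ip y (e k) = 0) -> ip s y = 0 &
  forall b, 0 <= b -> (forall n, qsum x n <= b ^+ 2) -> N s <= b].
Proof.
have [eps e0|s us] := ip_complete hip (u := psum x).
  have [n0 h] := qsum_cauchy x (exprn_gt0 2 e0).
  exists n0 => m n n0n nm; have := h _ _ n0n nm.
  by rewrite -sqnorm_psum_sub // ler_pXn2r // nnegrE ?ip_norm_ge0 ?ltW.
exists s; split.
- move=> k; have ux : converges_for N (fun n => x - psum x n) (x - s).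
    move=> eps /us[n0 h]; exists n0 => n /h; rewrite ip_norm_subC.
    by rewrite [_ - (x - s)](_ : _ = s - psum x n) // opprB addrC addrA subrK.
  apply: converges_ip0 ux _; exists k.+1 => n kn.
  by rewrite ipBl psum_coef kn subrr.
- move=> y ye; apply: converges_ip0 us _; exists 0%N => n _.
  rewrite ip_suml big1 // => k _.
  by rewrite ipZl (ip_conj hip) ye conjc0 mulr0.
- move=> b b0 hb; apply: converges_norm_le us _ => n.
  by rewrite -(@ler_pXn2r _ 2) ?nnegrE ?ip_norm_ge0 // sqnorm_psum.
Qed.

End hermitian.

(** * Geometrically convergent sequences *)

Section complete.
Context {R : realType} {V : lmodType R[i]}.
Variables (ip : V -> V -> R[i]) (hip : hilbert ip).
Local Notation N := (ip_norm ip).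
Implicit Types (x y : V) (u : nat -> V).

Lemma geometric_steps u (d q : R) : 0 <= d -> 0 <= q < 1 ->
  (forall n, N (u n.+1 - u n) <= d * q ^+ n) ->
  forall m n, (n <= m)%N -> N (u m - u n) <= d * q ^+ n / (1 - q).
Proof.
move=> d0 /andP[q0 q1] step m n /subnKC <-; set k := (m - n)%N.
have q' : 0 < 1 - q by lra.
apply: (@le_trans _ _ (d * q ^+ n * (1 - q ^+ k) / (1 - q))); last first.
  rewrite ler_pM2r ?invr_gt0 // ler_piMr ?mulr_ge0 ?exprn_ge0 //.
  by rewrite gerBl exprn_ge0.
elim: k => [|k IH]; first by rewrite addn0 subrr ip_norm0 // expr0 subrr mulr0 mul0r.
apply: le_trans (ip_norm_distD hip (u (n + k)%N) _ _) _; rewrite addnS.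
apply: le_trans (lerD (step _) IH) _.
rewrite exprD exprS le_eqVlt; apply/orP; left; apply/eqP; field.
by rewrite gt_eqF.
Qed.

Lemma geometric_limit u (d q : R) : 0 <= d -> 0 <= q < 1 ->
  (forall n, N (u n.+1 - u n) <= d * q ^+ n) ->
  exists x, converges_for N u x /\ forall n, N (u n - x) <= d * q ^+ n / (1 - q).
Proof.
move=> d0 q01 step; have [q0 q1] := andP q01.
have gs := geometric_steps d0 q01 step.
have [eps e0|x ux] := ip_complete hip (u := u).
  have : (fun n => q ^+ n) @ \oo --> (0 : R) by apply: cvg_expr; rewrite ger0_norm.
  move=> /cvgrPdist_le /(_ (eps * (1 - q) / (d + 1))).
  have q' : 0 < 1 - q by lra.
  have d1 : 0 < d + 1 by lra.
  rewrite !divr_gt0 ?mulr_gt0 // => /(_ isT)[n0 _ h].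
  exists n0 => m n n0n nm; apply: le_trans (gs _ _ nm) _.
  have := h n n0n; rewrite /= sub0r normrN ger0_norm ?exprn_ge0 //.
  rewrite !ler_pdivlMr ?ler_pdivrMr // => hn.
  have qn : 0 <= q ^+ n by exact: exprn_ge0.
  by rewrite mulrC; apply: le_trans hn; rewrite ler_wpM2l //; lra.
exists x; split=> // n; apply/ler_addgt0Pr => eps /ux[n1 h].
apply: le_trans (ip_norm_distD hip (u (maxn n n1)) _ _) _.
by rewrite lerD ?h ?leq_maxr // ip_norm_subC // gs ?leq_maxl.
Qed.

(** * The Lax-Milgram theorem *)

(** The equation A x = y is the fixed point equation of x - t w (A x - y), which
is a contraction for t small: the coercivity term is linear in t while the
boundedness term is quadratic. *)
Lemma lax_milgram (A : V -> V) (M c : R) (w : R[i]) :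
  {morph A : x y / x - y} -> (forall x, N (A x) <= M * N x) -> 0 <= M ->
  0 < c -> (forall x, c * N x ^+ 2 <= complex.Re (w * ip (A x) x)) ->
  exists B, [/\ bounded_op N B, cancel A B & cancel B A].
Proof.
move=> Alin Abd M0 c0 coer.
(* The summand c makes c / K at most one. *)
pose K : R := normc w * M + c.
have K0 : 0 < K by rewrite ltr_wpDl // mulr_ge0 ?normc_ge0.
have cK : c <= K by rewrite lerDr mulr_ge0 ?normc_ge0.
pose t : R := c / K ^+ 2.
have t0 : 0 < t by rewrite divr_gt0 // exprn_gt0.
(* Coercivity bounds A from below, which gives injectivity and the bound for the
   inverse. *)
have lower x : c * N x <= normc w * N (A x).
  have [x0|x0] := eqVneq (N x) 0.
    by rewrite x0 mulr0 mulr_ge0 ?normc_ge0 ?ip_norm_ge0.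
  have xp : 0 < N x by rewrite lt_def x0 ip_norm_ge0.
  rewrite -(ler_pM2r xp) -mulrA -expr2; apply: (le_trans (coer x)).
  apply: le_trans (ler_norm _) _; apply: le_trans (normc_ge_Re_norm _) _.
  by rewrite normcM -mulrA ler_wpM2l ?normc_ge0 ?(cauchy_schwarz hip).
have Ainj x y : A x = A y -> x = y.
  move=> Axy; apply/eqP; rewrite -subr_eq0; apply/eqP/(ip_norm_eq0 hip).
  have := lower (x - y); rewrite Alin Axy subrr ip_norm0 // mulr0.
  rewrite pmulr_rle0 // => h; apply/eqP; by rewrite eq_le h ip_norm_ge0.
have contr x : N (x - (t%:C * w) *: A x) ^+ 2 <= (1 - (c / K) ^+ 2) * N x ^+ 2.
  rewrite ip_norm_sqB // ip_normZ // ipZr // (ip_conj hip (A x)).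
  have -> : complex.Re ((t%:C * w)^*%C * (ip (A x) x)^*%C) =
      t * complex.Re (w * ip (A x) x).
    by case: (w) (ip (A x) x) => [? ?] [? ?] /=; ring.
  have h1 : normc (t%:C * w) * N (A x) <= c / K * N x.
    rewrite normcM normc_real gtr0_norm //.
    apply: (@le_trans _ _ (t * (K * N x))); last first.
      by rewrite /t le_eqVlt; apply/orP; left; apply/eqP; field; rewrite gt_eqF.
    rewrite -mulrA ler_pM2l //.
    apply: (@le_trans _ _ (normc w * M * N x)).
      by rewrite -mulrA ler_wpM2l ?normc_ge0.
    by rewrite ler_wpM2r ?ip_norm_ge0 // lerDl ltW.
  have h2 : (normc (t%:C * w) * N (A x)) ^+ 2 <= (c / K * N x) ^+ 2.
    by rewrite ler_pXn2r // nnegrE mulr_ge0 ?divr_ge0 ?normc_ge0 ?ip_norm_ge0 // ltW.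
  have h3 : (c / K) ^+ 2 * N x ^+ 2 <= t * complex.Re (w * ip (A x) x).
    apply: le_trans (ler_wpM2l (ltW t0) (coer x)).
    by rewrite /t le_eqVlt; apply/orP; left; apply/eqP; field; rewrite gt_eqF.
  by rewrite exprMn in h2; lra.
have surj y : exists x, A x = y.
  pose F x := x - (t%:C * w) *: (A x - y).
  pose q := Num.sqrt (1 - (c / K) ^+ 2).
  have cK1 : 0 < c / K <= 1 by rewrite divr_gt0 // ler_pdivrMr // mul1r.
  have cK2 : 0 < (c / K) ^+ 2 <= 1.
    have [? ?] := andP cK1; rewrite exprn_gt0 //=.
    by rewrite expr2 mulr_ile1 // ltW.
  have q01 : 0 <= q < 1.
    by rewrite sqrtr_ge0 -[ltRHS]sqrtr1 ltr_sqrt; lra.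
  have Fc x z : N (F x - F z) <= q * N (x - z).
    have -> : F x - F z = (x - z) - (t%:C * w) *: A (x - z).
      rewrite /F Alin opprD addrACA -opprD -scalerBr.
      by congr (_ - _ *: _); rewrite opprB addrA subrK.
    rewrite -(@ler_pXn2r _ 2) ?nnegrE ?mulr_ge0 ?ip_norm_ge0 ?sqrtr_ge0 //.
    rewrite exprMn [q ^+ 2]sqr_sqrtr; last by have [_ ?] := andP cK2; rewrite subr_ge0.
    exact: contr.
  pose u n := iter n F 0.
  have [n|x [ux _]] := @geometric_limit u (N (F 0 - 0)) q (ip_norm_ge0 _ _) q01.
    elim: n => [|n IH]; first by rewrite expr0 mulr1.
    apply: (le_trans (Fc _ _)); rewrite exprS mulrCA.
    by have /andP[? _] := q01; exact: ler_wpM2l.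
  exists x; have [q0 q1] := andP q01.
  have Fx : N (x - F x) = 0.
    apply/eqP; rewrite eq_le ip_norm_ge0 andbT; apply/ler_addgt0Pr => eps e0.
    rewrite add0r; have [n h] := ux _ (divr_gt0 e0 (ltr0Sn R 1)).
    apply: le_trans (ip_norm_distD hip (u n.+1) _ _) _.
    rewrite [leRHS](splitr eps) lerD //; first by rewrite ip_norm_subC ?h.
    apply: le_trans (Fc _ _) _; apply: le_trans (h n (leqnn n)).
    by rewrite ler_piMl ?ip_norm_ge0 ?ltW.
  move: (ip_norm_eq0 hip Fx); rewrite /F opprB addrC subrK => /eqP.
  rewrite scaler_eq0 mulf_eq0 => /orP[/orP[|]|].
  - by rewrite (inj_eq (@complexI R)) gt_eqF.
  (* If w vanishes, coercivity forces the whole space to be zero. *)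
  - move=> /eqP w0; apply/eqP; rewrite -subr_eq0; apply/eqP/(ip_norm_eq0 hip).
    have := lower (A x - y); rewrite w0 normc0 mul0r pmulr_rle0 // => h.
    by apply/eqP; rewrite eq_le h ip_norm_ge0.
  - by rewrite subr_eq0 => /eqP.
have [B BK] := choice surj.
have BK' : cancel A B by move=> x; apply: Ainj; rewrite BK.
exists B; split=> //.
exists (normc w / c) => x; rewrite mulrAC ler_pdivlMr //.
by have := lower (B x); rewrite BK mulrC.
Qed.

(** * Uniform boundedness *)

(** One of the two points x + v and x - v, for v a multiple of z, has a scalar product
with z at least as large as that of v. Moving along the sequence in this way with
rapidly decreasing steps leads to a point at which the scalar products are
unbounded. *)
Lemma uniform_boundedness (z : nat -> V) :
  (forall k, k%:R * 3 ^+ k <= N (z k)) ->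
  exists x, forall C, exists k, C < normc (ip x (z k)).
Proof.
move=> zk.
have step k x : exists x', N (x' - x) <= (1/3) ^+ k /\
    (1/3) ^+ k * N (z k) <= normc (ip x' (z k)).
  have p0 : 0 <= (1/3) ^+ k :> R by rewrite exprn_ge0.
  have [z0|z0] := eqVneq (N (z k)) 0.
    by exists x; rewrite subrr ip_norm0 // z0 mulr0 normc_ge0.
  pose v := ((1/3) ^+ k / N (z k))%:C *: z k.
  have zp : 0 < N (z k) by rewrite lt_def z0 ip_norm_ge0.
  have Nv : N v = (1/3) ^+ k.
    by rewrite ip_normZ // normc_real ger0_norm ?divr_ge0 ?ltW // divfK.
  have ipv : ip v (z k) = ((1/3) ^+ k * N (z k))%:C.
    by rewrite ipZl // ip_xx // -rmorphM expr2 mulrA divfK.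
  set r := _ * N (z k); have r0 : 0 <= r by rewrite mulr_ge0 // ltW.
  have [h|h] := leP r (normc (ip (x + v) (z k))).
    by exists (x + v); rewrite addrAC subrr add0r Nv.
  exists (x - v); rewrite addrAC subrr add0r ip_normN // Nv; split=> //.
  have : normc (2%:R * ip v (z k)) <=
      normc (ip (x + v) (z k)) + normc (ip (x - v) (z k)).
    rewrite -(normcN (ip (x - v) _)); apply: le_trans (le_normcD _ _).
    by rewrite ipDl // ipBl // opprB (addrC (_ + _)) addrA subrK mulr_natl.
  rewrite ipv normcM normc_real ger0_norm // -/r.
  have -> : normc (2%:R : R[i]) = 2.
    by rewrite -(rmorph_nat (real_complex R)) normc_real ger0_norm.
  by lra.
have [next nextP] := choice (fun kx : nat * V => step kx.1 kx.2).
pose u := fix u k := if k is j.+1 then next (j, u j) else 0.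
have third : 0 <= (1/3 : R) < 1 by apply/andP; split; lra.
have [n|x [_ ux]] := @geometric_limit u 1 (1/3) ler01 third.
  by rewrite mul1r; have [] := nextP (n, u n).
exists x => C; exists (Num.truncn (2 * C)).+1.
set k := _.+1; have Ck : 2 * C < k%:R by exact: truncnS_gt.
have [_ h] := nextP (k, u k); rewrite -/(u k.+1) /= in h.
have e0 : 0 < (1/3) ^+ k :> R by rewrite exprn_gt0 //; lra.
(* All steps after the k-th one together are at most half as long as the k-th. *)
have h1 : normc (ip (next (k, u k) - x) (z k)) <= (1/3) ^+ k / 2 * N (z k).
  apply: le_trans (cauchy_schwarz hip _ _) _; rewrite ler_wpM2r ?ip_norm_ge0 //.
  apply: le_trans (ux k.+1) _; rewrite exprS le_eqVlt; apply/orP; left.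
  by apply/eqP; field.
have h2 := le_normcD (ip (next (k, u k) - x) (z k)) (ip x (z k)).
rewrite -ipDl // subrK in h2.
have h3 : k%:R <= (1/3) ^+ k * N (z k).
  apply: le_trans (ler_wpM2l (ltW e0) (zk k)).
  by rewrite mulrCA -exprMn (_ : 1/3 * 3 = 1 :> R) ?expr1n ?mulr1 //; field.
by lra.
Qed.

(** A symmetric operator whose range has finite codimension is bounded below on
almost orthogonal complements of finitely many vectors: otherwise rescaled
almost null vectors of unbounded norm would have bounded scalar products with the
range and with the vectors spanning a complement, hence with everything. *)
Lemma finite_codim_bounded_below (A : V -> V) :
  (forall a x, A (a *: x) = a *: A x) ->
  (forall x y, ip (A x) y = ip x (A y)) -> finite_codim (range A) ->
  exists n (v : 'I_n -> V) (eps : R), 0 < eps /\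
    forall w, (forall i, normc (ip (v i) w) <= eps * N w) ->
      N (A w) <= eps * N w -> w = 0.
Proof.
move=> AZ symA [n [v vP]]; exists n, v.
apply: contrapT => /forallNP hno.
pose s (k : nat) : R := k%:R * 3 ^+ k.
have s0 k : 0 <= s k by rewrite mulr_ge0 ?exprn_ge0.
have hz k : exists z, [/\ s k <= N z, N (A z) <= 1 & forall i, normc (ip (v i) z) <= 1].
  have sk1 : 0 < s k + 1 by rewrite ltr_wpDl.
  have [w /not_implyP[h1 /not_implyP[h2 w0]]] : exists w, ~ (
    (forall i, normc (ip (v i) w) <= (s k + 1)^-1 * N w) ->
      N (A w) <= (s k + 1)^-1 * N w -> w = 0).
    apply: contrapT => /forallNP h; apply: (hno (s k + 1)^-1); split.
      by rewrite invr_gt0.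
    by move=> w; apply: contrapT; exact: h.
  have wp : 0 < N w.
    by rewrite lt_def ip_norm_ge0 andbT; apply/eqP => /(ip_norm_eq0 hip).
  pose a : R := (s k + 1) / N w; have a0 : 0 < a by rewrite divr_gt0.
  have na : normc a%:C = a by rewrite normc_real gtr0_norm.
  have aK r : r <= (s k + 1)^-1 * N w -> a * r <= 1.
    by move=> h; rewrite /a mulrAC ler_pdivrMr // mul1r -ler_pdivlMl.
  exists (a%:C *: w); split.
  - by rewrite ip_normZ // na divfK ?gt_eqF // lerDl.
  - by rewrite AZ ip_normZ // na aK.
  - by move=> i; rewrite ipZr // conjc_real normcM na aK.
have [z zP] := choice hz.
have [|x xz] := @uniform_boundedness z; first by move=> k; have [] := zP k.
have [c [y _ xy]] := vP x.
have [k] := xz (N y + \sum_(i < n) normc (c i)); apply/negP; rewrite -leNgt.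
have -> : x = A y + \sum_(i < n) c i *: v i by rewrite xy subrK.
have [_ h1 h2] := zP k.
rewrite ipDl // symA ip_suml //; apply: le_trans (le_normcD _ _) _.
apply: lerD.
  by apply: le_trans (cauchy_schwarz hip _ _) _; rewrite ler_piMr ?ip_norm_ge0.
elim/big_ind2: _ => [|a1 b1 a2 b2 ab1 ab2|i _].
- by rewrite normc0.
- by apply: le_trans (le_normcD _ _) _; rewrite lerD.
- by rewrite ipZl // normcM ler_piMr ?normc_ge0.
Qed.

End complete.

(** * The scalar product of square-integrable classes *)

Section l2_inner.
Context d (T : measurableType d) (R : realType) (mu : {measure set T -> \bar R}).
Implicit Types (x y z : L2 mu).

Lemma measurable_conjc (g : T -> R[i]) : measurable_fun setT g ->
  measurable_fun setT (fun t => (g t)^*%C).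
Proof.
move=> /measurable_complexP[g1 g2]; apply/measurable_complexP; split.
  by rewrite (_ : (fun _ => _) = (fun t => complex.Re (g t))) //;
    apply/funext => t; case: (g t).
rewrite (_ : (fun _ => _) = (fun t => - complex.Im (g t))).
  exact: measurableT_comp.
by apply/funext => t; case: (g t).
Qed.

Lemma sqint_conjc (g : T -> R[i]) : g \in sqint mu ->
  (fun t => (g t)^*%C) \in sqint mu.
Proof.
move=> /sqintP[mg ig]; apply/sqintP; split; first exact: measurable_conjc.
by under eq_integral do rewrite normc_conj.
Qed.

Definition sqint_of (g : T -> R[i]) (sg : g \in sqint mu) : sqint_fun mu :=
  exist _ g sg.

Lemma L2_measurable x : measurable_fun setT x.
Proof. by have /sqintP[] := L2_sqint x. Qed.

Lemma L2_norm_ge0 x : 0 <= L2_norm x. Proof. exact: sqrtr_ge0. Qed.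

Lemma L2_norm_integral x :
  (\int[mu]_t (normc (x t) ^+ 2)%:E = (L2_norm x ^+ 2)%:E)%E.
Proof.
have /sqintP[_ ix] := L2_sqint x.
rewrite /L2_norm sqr_sqrtr; last by apply: Rintegral_ge0 => t _; exact: sqr_ge0.
rewrite /Rintegral fineK // ge0_fin_numE //.
by apply: integral_ge0 => t _; rewrite lee_fin sqr_ge0.
Qed.

(** Norms and scalar products of classes are computed through any convenient almost
everywhere representatives. *)
Lemma L2_norm_integral_ae x (g : T -> R[i]) : measurable_fun setT g ->
  {ae mu, forall t, x t = g t} ->
  (\int[mu]_t (normc (g t) ^+ 2)%:E = (L2_norm x ^+ 2)%:E)%E.
Proof.
move=> mg xg; rewrite -L2_norm_integral; apply: ge0_ae_eq_integral => //.
- exact: measurable_normc_sqr.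
- exact: (measurable_normc_sqr (L2_measurable x)).
- by move=> t _; rewrite lee_fin sqr_ge0.
- by move=> t _; rewrite lee_fin sqr_ge0.
- by apply: filterS xg => t -> _.
Qed.

Lemma L2_ext x y : {ae mu, forall t, x t = y t} -> x = y.
Proof. by move=> xy; rewrite -[x]L2_reprK -[y]L2_reprK; apply/L2_class_eq. Qed.

Lemma L2_sub_ae x y : {ae mu, forall t, (x - y : L2 mu) t = x t - y t}.
Proof.
have := L2_lin_ae (-1) y x; rewrite scaleN1r addrC; apply: filterS => t ->.
by rewrite mulN1r addrC.
Qed.

Lemma L2_zero_ae : {ae mu, forall t, (0 : L2 mu) t = 0}.
Proof.
by have := L2_sub_ae 0 0; rewrite subrr; apply: filterS => t ->; rewrite subrr.
Qed.

Lemma L2_scale_ae a x : {ae mu, forall t, (a *: x : L2 mu) t = a * x t}.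
Proof.
have := L2_lin_ae a x 0; rewrite addr0; apply: filterS2 L2_zero_ae => t h ->.
by rewrite h addr0.
Qed.

Lemma inner_linear a x y z : inner (a *: x + y) z = a * inner x z + inner y z.
Proof.
have sz := sqint_conjc (L2_sqint z).
rewrite /inner -cint_mul_linear ?L2_sqint //.
apply: eq_cint_mul_ae => //; first exact: L2_sqint.
  exact: (rpredD (rpredZ a (L2_sqint x)) (L2_sqint y)).
exact: L2_lin_ae.
Qed.

Lemma inner_ae x y (g h : T -> R[i]) : g \in sqint mu -> h \in sqint mu ->
  {ae mu, forall t, x t = g t} -> {ae mu, forall t, y t = h t} ->
  inner x y = cint mu (fun t => g t * (h t)^*%C).
Proof.
move=> sg sh xg yh.
rewrite /inner (eq_cint_mul_ae (L2_sqint x) sg (sqint_conjc (L2_sqint y)) xg).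
have mulCfun (u v : T -> R[i]) : (fun t => u t * v t) = (fun t => v t * u t).
  by apply/funext => t; rewrite mulrC.
rewrite mulCfun [in RHS]mulCfun.
apply: eq_cint_mul_ae => //; do ?exact: sqint_conjc (L2_sqint y).
  exact: sqint_conjc.
by apply: filterS yh => t ->.
Qed.

Lemma inner_conj x y : inner y x = (inner x y)^*%C.
Proof.
have [i1 i2] := sqint_mul_integrable (L2_sqint x) (sqint_conjc (L2_sqint y)).
rewrite /inner /cint /=; congr (_ +i* _).
  by congr Rintegral; apply/funext => t; case: (x t) (y t) => [? ?] [? ?] /=; ring.
rewrite -mulN1r -RintegralZl //; congr Rintegral; apply/funext => t.
by case: (x t) (y t) => [? ?] [? ?] /=; ring.
Qed.

Lemma inner_xx x : inner x x = (L2_norm x ^+ 2)%:C.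
Proof.
rewrite /inner /cint sqr_sqrtr; last by apply: Rintegral_ge0 => t _; exact: sqr_ge0.
congr (_ +i* _).
  by congr Rintegral; apply/funext => t; rewrite normc_sqr; case: (x t) => ? ? /=; ring.
rewrite (_ : (fun _ => _) = cst 0); last first.
  by apply/funext => t; case: (x t) => ? ? /=; ring.
by rewrite /Rintegral integral0.
Qed.

Lemma ip_norm_inner x : ip_norm (@inner _ _ _ mu) x = L2_norm x.
Proof. by rewrite /ip_norm inner_xx /= sqrtr_sqr ger0_norm // L2_norm_ge0. Qed.

Lemma L2_norm_eq0 x : L2_norm x = 0 -> x = 0.
Proof.
move=> x0; have := L2_norm_integral x; rewrite x0 expr0n /=.
under eq_integral => t _ do rewrite -[(_)%:E]gee0_abs ?lee_fin ?sqr_ge0 //.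
move/(ae_eq_integral_abs mu measurableT (measurable_normc_sqr (L2_measurable x))).
move=> h; apply: L2_ext; apply: filterS2 h L2_zero_ae => t h ->.
by have [] := h I; move/eqP; rewrite sqrf_eq0 => /eqP/eq0_normc.
Qed.

End l2_inner.

(** * Completeness of the space of square-integrable classes *)

Section l2_complete.
Context d (T : measurableType d) (R : realType) (mu : {measure set T -> \bar R}).

Lemma measurable_complexB (f g : T -> R[i]) :
  measurable_fun setT f -> measurable_fun setT g ->
  measurable_fun setT (fun t => f t - g t).
Proof.
move=> mf mg; apply: measurable_complexD => //.
rewrite (_ : (fun _ => _) = (fun t => (-1) * g t)).
  by apply: measurable_complexM => //; exact: measurable_cst.
by apply/funext => t; rewrite mulN1r.
Qed.

(** The weighted sum of the squared increments has a finite integral, hence is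
finite almost everywhere. *)
Lemma fast_increments_ae (f : nat -> T -> R[i]) :
  (forall n, measurable_fun setT (f n)) ->
  (forall n, \int[mu]_t (normc (f n.+1 t - f n t) ^+ 2)%:E <=
    ((1/8) ^+ n.+1)%:E)%E ->
  {ae mu, forall t, exists C, forall n, normc (f n.+1 t - f n t) <= C * (1/2) ^+ n}.
Proof.
move=> mf hf.
(* The weight 4 ^ n.+1 still leaves integrals bounded by (1/2) ^ n.+1, and finiteness
   of the sum then bounds the n-th increment by a multiple of (1/2) ^ n. *)
pose g n t : \bar R := ((4 ^+ n.+1)%:E * (normc (f n.+1 t - f n t) ^+ 2)%:E)%E.
have g0 n t : (0 <= g n t)%E.
  by rewrite /g -EFinM lee_fin mulr_ge0 ?sqr_ge0 ?exprn_ge0.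
have mg n : measurable_fun setT (g n).
  by apply: measurable_funeM; apply: measurable_normc_sqr; exact: measurable_complexB.
have ig : (\int[mu]_t (\sum_(n <oo) g n t) <= 1)%E.
  rewrite integral_nneseries //.
  apply: (le_trans _ (@epsilon_trick0 R 1 xpredT ler01)).
  apply: lee_nneseries => [n _ _|n _]; first exact: integral_ge0.
  rewrite ge0_integralZl_EFin ?exprn_ge0 //; last 2 first.
  - by move=> t _; rewrite lee_fin sqr_ge0.
  - by apply: measurable_normc_sqr; exact: measurable_complexB.
  apply: le_trans (lee_wpmul2l _ (hf n)) _; first by rewrite lee_fin exprn_ge0.
  rewrite -EFinM lee_fin -exprMn natrX (_ : 4 * (1/8) = 1/2 :> R); last by field.
  by rewrite expr_div_n expr1n.
have mG : measurable_fun setT (fun t => \sum_(n <oo) g n t)%E.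
  by apply: ge0_emeasurable_sum => // k t _ _; exact: g0.
have G0 t : (0 <= \sum_(n <oo) g n t)%E by apply: nneseries_ge0.
have : mu.-integrable setT (fun t => \sum_(n <oo) g n t)%E.
  apply/integrableP; split=> //.
  under eq_integral => t _ do rewrite gee0_abs //.
  by apply: le_lt_trans ig _; exact: ltry.
move=> /(integrable_ae measurableT); apply: filterS => t /(_ I) fin.
pose S := fine (\sum_(n <oo) g n t)%E.
have ES : (\sum_(n <oo) g n t = S%:E)%E by rewrite /S fineK.
have S0 : 0 <= S by rewrite -lee_fin -ES.
exists (Num.sqrt S) => n.
have : (g n t <= S%:E)%E.
  rewrite -ES; apply: (le_trans _ (nneseries_lim_ge n.+1 _)) => //.
  rewrite big_nat_recr //= leeDr //; apply: sume_ge0 => i _; exact: g0.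
rewrite /g -EFinM lee_fin exprS => h.
rewrite -(@ler_pXn2r _ 2) ?nnegrE ?mulr_ge0 ?normc_ge0 ?sqrtr_ge0 ?exprn_ge0 //.
rewrite exprMn sqr_sqrtr // -exprM mulnC exprM.
have -> : (1/2) ^+ 2 = 4^-1 :> R by field.
have p4 : 0 < 4 ^+ n :> R by rewrite exprn_gt0.
rewrite exprVn ler_pdivlMr //.
apply: le_trans h; rewrite mulrC ler_wpM2r ?sqr_ge0 // ler_peMl ?(ltW p4) //.
by rewrite ler1n.
Qed.

Lemma cvg_fast_increments (u : nat -> R) C :
  (forall n, `|u n.+1 - u n| <= C * (1/2) ^+ n) -> cvgn u.
Proof.
move=> h; suff : cvgn (series (telescope u)).
  rewrite telescopeK => hc.
  rewrite (_ : u = (fun n => (u n - u 0%N) + u 0%N)); last first.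
    by apply/funext => n; rewrite subrK.
  by apply: is_cvgD => //; exact: is_cvg_cst.
apply: normed_cvg; apply: (@series_le_cvg _ _ (geometric C (1/2))) => //.
- by move=> n; exact: normr_ge0.
- by move=> n; exact: le_trans (normr_ge0 _) (h n).
- by apply: is_cvg_geometric_series; rewrite ger0_norm; lra.
Qed.

(** Superior limits make the limit function measurable without restricting to the set
of convergence. *)
Definition ae_limit (f : nat -> T -> R[i]) (t : T) : R[i] :=
  fine (limn_esup (fun n => (complex.Re (f n t))%:E)) +i*
  fine (limn_esup (fun n => (complex.Im (f n t))%:E)).

Lemma measurable_ae_limit (f : nat -> T -> R[i]) :
  (forall n, measurable_fun setT (f n)) -> measurable_fun setT (ae_limit f).
Proof.
move=> mf; apply/measurable_complexP; split => /=.
  apply: measurableT_comp => //; apply: measurable_fun_limn_esup => n.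
  by apply/measurable_EFinP; have /measurable_complexP[] := mf n.
apply: measurableT_comp => //; apply: measurable_fun_limn_esup => n.
by apply/measurable_EFinP; have /measurable_complexP[] := mf n.
Qed.

Lemma cvg_ae_limit (f : nat -> T -> R[i]) t C :
  (forall n, normc (f n.+1 t - f n t) <= C * (1/2) ^+ n) ->
  (fun n => complex.Re (f n t)) @ \oo --> complex.Re (ae_limit f t) /\
  (fun n => complex.Im (f n t)) @ \oo --> complex.Im (ae_limit f t).
Proof.
move=> h.
have aux (u : nat -> R) : cvgn u -> u @ \oo --> fine (limn_esup (EFin \o u)).
  move=> /cvg_ex[l ul]; have ul' : (EFin \o u) @ \oo --> l%:E.
    by apply: continuous_cvg.
  by have [_ ->] := cvg_limn_einf_sup ul'.
split; apply: aux; apply: (@cvg_fast_increments _ C) => n; apply: le_trans (h n).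
  by rewrite (le_trans _ (normc_ge_Re_norm _)) //;
    case: (f n t) (f n.+1 t) => [? ?] [? ?].
by rewrite (le_trans _ (normc_ge_Im_norm _)) //;
    case: (f n t) (f n.+1 t) => [? ?] [? ?].
Qed.

Lemma limn_einf_le (u : nat -> \bar R) b n0 :
  (forall n, (n0 <= n)%N -> (u n <= b)%E) -> (limn_einf u <= b)%E.
Proof.
move=> ub; apply: le_trans (limn_einf_sup u) _.
rewrite /limn_esup; apply: (@le_trans _ _ (ereal_sup (u @` [set k | (n0 <= k)%N]))).
  by apply: ereal_inf_lbound => /=; exists [set k | (n0 <= k)%N] => //=; exists n0.
by apply: ge_ereal_sup => _ [k /= nk <-]; exact: ub.
Qed.

(** The Riesz-Fischer theorem: a subsequence with summable increments converges
almost everywhere, and by the lemma of Fatou its pointwise limit is also the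
limit in the mean. *)
Lemma L2_complete (u : nat -> L2 mu) : cauchy_for (@L2_norm _ _ _ mu) u ->
  exists x, converges_for (@L2_norm _ _ _ mu) u x.
Proof.
move=> cu.
have hn k : exists n0, forall m n, (n0 <= n)%N -> (n <= m)%N ->
    L2_norm (u m - u n) ^+ 2 <= (1/8) ^+ k.+1.
  have p8 : 0 < (1/8) ^+ k.+1 :> R by rewrite exprn_gt0 //; lra.
  have [n0 h] := cu (Num.sqrt ((1/8) ^+ k.+1)) ltac:(by rewrite sqrtr_gt0).
  exists n0 => m n n0n nm; rewrite -[leRHS]sqr_sqrtr ?(ltW p8) //.
  by rewrite ler_pXn2r ?nnegrE ?L2_norm_ge0 ?sqrtr_ge0 ?h.
have [n0 n0P] := choice hn.
(* Adding k and all previous thresholds makes phi monotone and unbounded. *)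
pose phi k := (k + \sum_(j < k.+1) n0 j)%N.
have phiS k : (phi k <= phi k.+1)%N.
  by rewrite /phi [X in (_ <= _ + X)%N]big_ord_recr /= leq_add // leq_addr.
have phi0 k : (n0 k <= phi k)%N.
  by rewrite /phi big_ord_recr /= addnA leq_addl.
have phik k : (k <= phi k)%N by rewrite /phi leq_addr.
pose f k : T -> R[i] := u (phi k).
have mf k : measurable_fun setT (f k) by exact: L2_measurable.
have sub_int m n : (\int[mu]_t (normc (u m t - u n t) ^+ 2)%:E =
    (L2_norm (u m - u n) ^+ 2)%:E)%E.
  apply: L2_norm_integral_ae; last exact: L2_sub_ae.
  by apply: measurable_complexB; exact: L2_measurable.
have fast : {ae mu, forall t, exists C, forall n,
    normc (f n.+1 t - f n t) <= C * (1/2) ^+ n}.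
  apply: fast_increments_ae => // n.
  by rewrite sub_int lee_fin n0P.
pose F := ae_limit f; have mF := measurable_ae_limit mf.
have bound n b : (forall m, (n <= m)%N -> L2_norm (u m - u n) <= b) ->
    (\int[mu]_t (normc (F t - u n t) ^+ 2)%:E <= (b ^+ 2)%:E)%E.
  move=> hb.
  pose h k t : \bar R := (normc (f k t - u n t) ^+ 2)%:E.
  have mh k : measurable_fun setT (h k).
    apply: measurable_normc_sqr; apply: measurable_complexB => //.
    exact: L2_measurable.
  have h0 k t : (0 <= h k t)%E by rewrite lee_fin sqr_ge0.
  have ->: (\int[mu]_t (normc (F t - u n t) ^+ 2)%:E =
      \int[mu]_t limn_einf (h ^~ t))%E.
    apply: ge0_ae_eq_integral => //.
    - apply: measurable_normc_sqr; apply: measurable_complexB => //.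
      exact: L2_measurable.
    - apply: measurableT_comp => //; apply: measurable_fun_limn_esup => k.
      exact: measurableT_comp.
    - by move=> t _; rewrite lee_fin sqr_ge0.
    - move=> t _; rewrite limn_einf_lim; apply: lime_ge; first exact: is_cvg_einfs.
      by apply: nearW => k; apply: le_ereal_inf_tmp => _ [j _ <-]; exact: h0.
    apply: filterS fast => t [C hC] _; have [cr ci] := cvg_ae_limit hC.
    have hc : (h ^~ t) @ \oo --> (normc (F t - u n t) ^+ 2)%:E.
      have E (v w : R[i]) : normc (v - w) ^+ 2 =
          (complex.Re v - complex.Re w) ^+ 2 + (complex.Im v - complex.Im w) ^+ 2.
        by rewrite normc_sqr; case: v w => [? ?] [? ?].
      apply: continuous_cvg; first by [].
      rewrite E; under eq_fun do rewrite E.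
      by apply: cvgD; rewrite expr2; under eq_fun do rewrite expr2;
        apply: cvgM; apply: cvgB => //; exact: cvg_cst.
    by have [->] := cvg_limn_einf_sup hc.
  apply: le_trans (fatou mu measurableT mh _) _; first by move=> k t _; exact: h0.
  apply: (@limn_einf_le _ _ n) => k nk; rewrite sub_int lee_fin.
  have nphi := leq_trans nk (phik k).
  rewrite ler_pXn2r ?nnegrE ?L2_norm_ge0 ?hb //.
  by apply: le_trans (hb _ (leqnn n)); exact: L2_norm_ge0.
have sF : F \in sqint mu.
  have [m hm] := cu 1 ltr01.
  have sd : (fun t => F t - u m t) \in sqint mu.
    apply/sqintP; split; first by apply: measurable_complexB => //; exact: L2_measurable.
    apply: le_lt_trans (bound m 1 _) _; first by move=> k mk; exact: hm.
    by rewrite expr1n ltry.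
  have := rpredD sd (L2_sqint (u m)).
  by rewrite (_ : _ + _ = F) //; apply/funext => t; exact: subrK.
pose x : L2 mu := L2_class (sqint_of sF); exists x => eps e0.
have [m hm] := cu eps e0; exists m => n mn.
rewrite -(@ler_pXn2r _ 2) ?nnegrE ?L2_norm_ge0 ?(ltW e0) // -lee_fin.
rewrite -(@L2_norm_integral_ae _ _ _ mu _ (fun t => u n t - F t)).
- under eq_integral => t _ do rewrite -normcN opprB.
  by apply: bound => k nk; exact: hm.
- by apply: measurable_complexB => //; exact: L2_measurable.
- by apply: filterS2 (L2_sub_ae (u n) x) (L2_classK (sqint_of sF)) => t -> ->.
Qed.

Lemma inner_hilbert : hilbert (@inner _ _ _ mu).
Proof.
have EN : ip_norm (@inner _ _ _ mu) = @L2_norm _ _ _ mu.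
  by apply/funext => x; exact: ip_norm_inner.
split.
- exact: inner_linear.
- exact: inner_conj.
- by move=> x; rewrite inner_xx lecE /= eqxx sqr_ge0.
- by move=> x; rewrite inner_xx => -[/eqP]; rewrite sqrf_eq0 => /eqP/L2_norm_eq0.
- by rewrite EN; exact: L2_complete.
Qed.

End l2_complete.

(** * Orthonormality of the negative Fourier modes *)

Section circle.
Context {R : realType}.
Local Notation sigma := (circle_measure R).
Implicit Types (z : circle R).

Lemma expi_pow (t : R) n : \val (expi t) ^+ n = cos (n%:R * t) +i* sin (n%:R * t).
Proof.
elim: n => [|n IH]; first by rewrite expr0 mul0r cos0 sin0.
rewrite exprS IH -natr1 mulrDl mul1r cosD sinD /=; congr (_ +i* _); ring.
Qed.

Lemma circle_normc z : normc (\val z) = 1.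
Proof.
by have /eqP := valP z; rewrite normc_def; case: (\val z) => a b [].
Qed.

Lemma circle_normcX z n : normc (\val z ^+ n) = 1.
Proof.
by elim: n => [|n IH]; [exact: normc1 | rewrite exprS normcM circle_normc mul1r].
Qed.

Lemma circle_mul_conjX z n : \val z ^+ n * (\val z ^+ n)^*%C = 1.
Proof. by rewrite mulc_conj circle_normcX expr1n. Qed.

Lemma ge0_integral_circle (g : circle R -> \bar R) : measurable_fun setT g ->
  (forall z, 0 <= g z)%E ->
  (\int[sigma]_z g z =
   ((2 * pi)^-1)%:E * \int[lebesgue_measure]_(t in `[0%R, (2 * pi)%R[) g (expi t))%E.
Proof.
move=> mg g0.
pose m0 : {measure set (measurableTypeR R) -> \bar R} :=
  mrestr (@lebesgue_measure R) (measurable_itv `[0%R, (2 * pi)%R[).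
pose m1 : {measure set (measurableTypeR R) -> \bar R} :=
  mscale (NngNum (@inv2pi_ge0 R)) m0.
have mexpi : measurable_fun (setT : set (measurableTypeR R)) expi.
  exact: measurable_expi.
have mge : measurable_fun (setT : set (measurableTypeR R)) (g \o expi).
  exact: measurableT_comp.
have push := ge0_integral_pushforward mexpi m1 measurableT mg
  (fun z _ => g0 z).
transitivity (\int[m1]_t (g \o expi) t)%E.
  by rewrite preimage_setT in push; rewrite -push; exact: eq_measure_integral.
rewrite ge0_integral_mscale //; last by move=> t _; exact: g0.
congr (_ * _)%E.
pose D : set (measurableTypeR R) := `[0, 2 * pi[%classic.
have mD : measurable D by exact: measurable_itv.
have gD (A : set (measurableTypeR R)) : measurable A -> measurable_fun A (g \o expi).
  by move=> mA; exact: measurable_funTS.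
rewrite -(setUv D) ge0_integral_setU //; last 4 first.
- exact: measurableC.
- by rewrite setUv.
- by move=> x _; exact: g0.
- by apply/disj_setPRL.
rewrite [X in (_ + X)%E](_ : _ = 0%E) ?adde0; last first.
  rewrite (@ge0_negligible_integral _ _ _ m0 (~` D) (~` D)) ?setDv ?integral_set0 //.
  - exact: measurableC.
  - exact: measurableC.
  - by apply: gD; exact: measurableC.
  - by move=> x _; exact: g0.
  - by rewrite /m0 /= /mrestr setICl measure0.
by apply: eq_measure_integral => A mA AD; rewrite /m0 /= /mrestr setIidl.
Qed.

Lemma integral_derivative (f F : R -> R) (a b : R) : a < b -> continuous f ->
  (forall x : R, is_derive x (1 : R) F (f x)) ->
  (\int[lebesgue_measure]_(t in `[a, b[) (f t)%:E = (F b - F a)%:E)%E.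
Proof.
move=> ab cf dF.
have cF : continuous F.
  by move=> x; apply: differentiable_continuous; apply/derivable1_diffP; case: (dF x).
rewrite integral_itv_bndo_bndc; last first.
  apply/measurable_EFinP; apply: measurable_funTS; exact: continuous_measurable_fun.
rewrite (@continuous_FTC2 _ f F) // ?EFinB //.
- exact: continuous_subspaceT.
- split; first by move=> x _; case: (dF x).
  + by apply: cvg_at_right_filter; exact: cF.
  + by apply: cvg_at_left_filter; exact: cF.
- by move=> x _; rewrite derive1E; case: (dF x).
Qed.

(** Adding 1 makes the integrand nonnegative, so that the change of variables for
nonnegative functions applies. *)
Lemma Rintegral_circle (g : circle R -> R) : measurable_fun setT g ->
  (forall z, -1 <= g z <= 1) ->
  (\int[lebesgue_measure]_(t in `[0%R, (2 * pi)%R[) (1 + g (expi t))%:E =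
    (2 * pi)%:E)%E ->
  \int[sigma]_z g z = 0.
Proof.
move=> mg gb h.
have ig : sigma.-integrable setT (EFin \o g).
  apply: (@le_integrable _ _ _ sigma setT _ _ (cst 1%E)) => //.
  - exact/measurable_EFinP.
  - by move=> z _ /=; rewrite normr1 lee_fin ler_norml.
  - exact: finite_measure_integrable_cst.
have h1 : (\int[sigma]_z (1 + g z)%:E = 1)%E.
  rewrite ge0_integral_circle ?h -?EFinM ?mulVf ?gt_eqF ?mulr_gt0 ?pi_gt0 //.
    by apply/measurable_EFinP; exact: measurable_funD.
  by move=> z; rewrite lee_fin; have /andP[? _] := gb z; lra.
have := RintegralD (mu := sigma) measurableT (f1 := cst 1) (f2 := g)
  (finite_measure_integrable_cst sigma 1 measurableT) ig.
rewrite /Rintegral h1 /= integral_cst // -[X in (_ * X)%E]/(sigma setT).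
by rewrite probability_setT mule1 /=; lra.
Qed.

Lemma is_derive_antiderivatives (k x : R) : k != 0 ->
  is_derive x (1 : R) (fun t => t + k^-1 * sin (k * t)) (1 + cos (k * x)) /\
  is_derive x (1 : R) (fun t => t - k^-1 * cos (k * t)) (1 + sin (k * x)).
Proof.
move=> k0.
have dk : is_derive x (1 : R) ( *%R k) k.
  by apply: is_derive_eq; rewrite /GRing.scale /= mulr1.
split.
  have ds : is_derive x (1 : R) (fun t => sin (k * t)) (k * cos (k * x)).
    by apply: is_derive_eq (is_derive1_comp _ dk) _ => //; rewrite mulrC.
  by apply: is_derive_eq; rewrite /GRing.scale /= mulKf.
have dc : is_derive x (1 : R) (fun t => cos (k * t)) (k * - sin (k * x)).
  by apply: is_derive_eq (is_derive1_comp _ dk) _ => //; rewrite mulrC.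
by apply: is_derive_eq; rewrite /GRing.scale /= mulKf // opprK.
Qed.

Lemma cint_circle_pow n : (0 < n)%N -> cint sigma (fun z => \val z ^+ n) = 0.
Proof.
move=> n0; have n0' : n%:R != 0 :> R by rewrite pnatr_eq0 -lt0n.
have [mz _] := (sqintP _ _).1 (@sqint_zpow R n).
have [mre mim] := (measurable_complexP _).1 mz.
have pi2 : 0 < 2 * pi :> R by rewrite mulr_gt0 ?pi_gt0.
have per : cos (n%:R * (2 * pi)) = 1 :> R /\ sin (n%:R * (2 * pi)) = 0 :> R.
  have := expi_pow (2 * pi) n.
  rewrite /= (_ : 2 * pi = pi *+ 2) ?cos2pi ?sin2pi; last by rewrite mulr_natl.
  by rewrite expr1n => -[<- <-].
have ci : continuous (fun t : R => n%:R * t) by move=> t; exact: mulrl_continuous.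
have [cc cs] : continuous (fun t : R => 1 + cos (n%:R * t)) /\
    continuous (fun t : R => 1 + sin (n%:R * t)).
  split=> t; apply: cvgD; try exact: cvg_cst.
    by apply: continuous_comp; [exact: ci | exact: continuous_cos].
  by apply: continuous_comp; [exact: ci | exact: continuous_sin].
rewrite /cint; congr (_ +i* _); apply: Rintegral_circle => //.
- move=> z; rewrite -ler_norml -[leRHS](circle_normcX z n).
  exact: normc_ge_Re_norm.
- under eq_integral => t _ do rewrite expi_pow /=.
  rewrite (integral_derivative pi2 cc (fun t => (is_derive_antiderivatives t n0').1)).
  by rewrite per.2 !mulr0 sin0; congr EFin; ring.
- move=> z; rewrite -ler_norml -[leRHS](circle_normcX z n).
  exact: normc_ge_Im_norm.
- under eq_integral => t _ do rewrite expi_pow /=.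
  rewrite (integral_derivative pi2 cs (fun t => (is_derive_antiderivatives t n0').2)).
  by rewrite per.1 !mulr0 cos0; congr EFin; ring.
Qed.

(** On the circle the conjugate of z ^ n.+1 is the inverse power z ^ (- n.+1). *)
Definition conj_pow (n : nat) (z : circle R) : R[i] := (\val z ^+ n.+1)^*%C.

Lemma conj_pow_sqint n : conj_pow n \in sqint sigma.
Proof. exact: sqint_conjc (sqint_zpow n.+1). Qed.

Definition neg_mode n : L2 sigma := L2_class (sqint_of (conj_pow_sqint n)).

Lemma neg_mode_ae n : {ae sigma, forall z, neg_mode n z = conj_pow n z}.
Proof. exact: L2_classK. Qed.

Lemma neg_mode_orthonormal i j : inner (neg_mode i) (neg_mode j) = (i == j)%:R.
Proof.
have lt k l : (k < l)%N -> inner (neg_mode k) (neg_mode l) = 0.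
  move=> kl; rewrite (inner_ae (conj_pow_sqint k) (conj_pow_sqint l)
    (neg_mode_ae k) (neg_mode_ae l)) -(@cint_circle_pow (l - k)) ?subn_gt0 //.
  congr (cint _ _); apply/funext => z; rewrite /conj_pow conjcK.
  rewrite [in _ ^+ l.+1](_ : l.+1 = k.+1 + (l - k))%N; last first.
    by rewrite addSn subnKC // ltnW.
  by rewrite exprD mulrA [_^*%C * _]mulrC circle_mul_conjX mul1r.
have [->|] := eqVneq i j.
  rewrite (inner_ae (conj_pow_sqint j) (conj_pow_sqint j)
    (neg_mode_ae j) (neg_mode_ae j)).
  rewrite (_ : (fun _ => _) = cst 1); last first.
    by apply/funext => z; rewrite /conj_pow conjcK mulrC circle_mul_conjX.
  have E (c : R) : \int[sigma]_z (cst c) z = c.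
    by rewrite Rintegral_cst // -[X in fine X]/(sigma setT) probability_setT mulr1.
  by rewrite /cint; congr (_ +i* _); exact: E.
rewrite neq_ltn => /orP[/lt//|/lt ji].
by rewrite inner_conj ji conjc0.
Qed.

Lemma fourier_neg (x : L2 sigma) n : fourier x (Negz n) = inner x (neg_mode n).
Proof.
rewrite (inner_ae (L2_sqint x) (conj_pow_sqint n) (aeW _ _) (neg_mode_ae n)) //.
by rewrite /fourier /conj_pow; congr cint; apply/funext => z; rewrite conjcK NegzE opprK.
Qed.

(** The Hardy space is by definition the orthogonal complement of the negative modes;
this is all that is needed to project onto it. *)
Lemma hardyP (x : L2 sigma) : x \in hardy <-> forall n, inner x (neg_mode n) = 0.
Proof.
split=> [/set_mem hx n|hx]; first by rewrite -fourier_neg hx.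
by apply/mem_set => -[] // n _; rewrite fourier_neg hx.
Qed.

End circle.

(** * Spectra of operators given by forms *)

Section spectra.
Context {R : realType} {V : lmodType R[i]}.
Variables (ip : V -> V -> R[i]) (hip : hilbert ip).
Local Notation N := (ip_norm ip).

(** Off the half-line the numerical range of the shifted operator stays in a
half-plane at positive distance from zero, once rotated by a suitable scalar. *)
Lemma nonneg_form_positive_op (A : V -> V) (M : R) :
  {morph A : x y / x - y} -> 0 <= M -> (forall x, N (A x) <= M * N x) ->
  (forall x, 0 <= ip (A x) x) -> positive_op N A.
Proof.
move=> Alin M0 Abd A0 l /=; apply: contra_notT => l0.
have shift_lin : {morph shift_op A l : x y / x - y}.
  by move=> x y; rewrite /shift_op Alin scalerBr !opprD addrACA.
have shift_bd x : N (shift_op A l x) <= (M + normc l) * N x.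
  rewrite mulrDl; apply: le_trans (ip_normB hip _ _) _.
  by rewrite ip_normZ // lerD.
have shiftE x (w : R[i]) : complex.Re (w * ip (shift_op A l x) x) =
    complex.Re w * complex.Re (ip (A x) x) - complex.Re (w * l) * N x ^+ 2.
  rewrite /shift_op ipBl // ipZl // ip_xx //.
  have := A0 x; case: (ip (A x) x) => a b; rewrite lecE /= => /andP[/eqP -> _].
  by case: w l {l0 shift_lin shift_bd} => [? ?] [? ?] /=; ring.
have [w [c [c0 coer]]] : exists w c, 0 < c /\
    forall x, c * N x ^+ 2 <= complex.Re (w * ip (shift_op A l x) x).
  move: l0; rewrite lecE negb_and -ltNge /= => l0.
  have [b0|b0] := eqVneq (complex.Im l) 0.
    exists 1, (- complex.Re l); rewrite b0 eqxx /= in l0.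
    split; first by rewrite oppr_gt0.
    move=> x; rewrite shiftE mul1r /= mul1r.
    by have := A0 x; rewrite lecE /= => /andP[_]; lra.
  (* Multiplication by i (Im l) turns the imaginary part of the form, which is
     - (Im l) |x|^2, into a positive real part. *)
  exists (0 +i* complex.Im l), (complex.Im l ^+ 2); split.
    by rewrite lt_def sqr_ge0 sqrf_eq0 b0.
  move=> x; rewrite shiftE; case: (l) => a b /=; rewrite le_eqVlt; apply/orP; left.
  by apply/eqP; ring.
by apply: (lax_milgram hip shift_lin shift_bd _ c0 coer); rewrite addr_ge0 ?normc_ge0.
Qed.

(** An invertible operator has trivial kernel and full range, so it is Fredholm: the
essential spectrum is part of the spectrum. *)
Lemma positive_op_ess_positive (nrm : V -> R) (A : V -> V) :
  {morph A : x y / x - y} -> positive_op nrm A -> ess_positive_op A.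
Proof.
move=> Alin pA l nf; apply: pA => -[B [_ BK KB]]; apply: nf.
have shift0 : shift_op A l 0 = 0.
  by rewrite /shift_op scaler0 subr0 -[in LHS](subrr (0 : V)) Alin subrr.
split.
  exists 0%N, (fun=> 0) => x /= x0; exists (fun=> 0).
  by rewrite big_ord0 -(BK x) x0 -shift0 BK.
exists 0%N, (fun=> 0) => x; exists (fun=> 0); exists (B x) => //.
by rewrite KB big_ord0 subr0.
Qed.

End spectra.

(** * Multiplication operators *)

Section multiplication.
Context d (T : measurableType d) (R : realType) (mu : {measure set T -> \bar R}).
Implicit Types (x y : L2 mu) (f : Linfty mu).

Lemma L2_mul_ae f x : {ae mu, forall t, L2_mul f x t = f t * x t}.
Proof.
exact: (L2_classK (sqint_of (Linfty_mul_sqint f (L2_repr x)))).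
Qed.

Lemma L2_mulB f x y : L2_mul f (x - y) = L2_mul f x - L2_mul f y.
Proof.
apply: L2_ext.
near=> t; rewrite (near (L2_mul_ae f (x - y))) // (near (L2_sub_ae x y)) //.
rewrite (near (L2_sub_ae (L2_mul f x) (L2_mul f y))) //.
by rewrite (near (L2_mul_ae f x)) // (near (L2_mul_ae f y)) // mulrBr.
Unshelve. all: by end_near. Qed.

Lemma L2_mulZ f a x : L2_mul f (a *: x) = a *: L2_mul f x.
Proof.
apply: L2_ext.
near=> t; rewrite (near (L2_mul_ae f (a *: x))) // (near (L2_scale_ae a x)) //.
rewrite (near (L2_scale_ae a (L2_mul f x))) // (near (L2_mul_ae f x)) //.
by rewrite mulrCA.
Unshelve. all: by end_near. Qed.

Lemma L2_norm_le_ae x y (C : R) : 0 <= C ->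
  {ae mu, forall t, normc (x t) <= C * normc (y t)} ->
  L2_norm x <= C * L2_norm y.
Proof.
move=> C0 xy; have mx := measurable_normc_sqr (L2_measurable x).
have my := measurable_normc_sqr (L2_measurable y).
rewrite -(@ler_pXn2r _ 2) ?nnegrE ?mulr_ge0 ?L2_norm_ge0 // -lee_fin.
rewrite exprMn (EFinM (C ^+ 2)) -!L2_norm_integral -ge0_integralZl_EFin ?sqr_ge0 //;
  last first.
  by move=> t _; rewrite lee_fin sqr_ge0.
apply: ae_ge0_le_integral => //.
- by move=> t _; rewrite lee_fin sqr_ge0.
- by move=> t _; rewrite mule_ge0 ?lee_fin ?sqr_ge0.
- exact: measurable_funeM.
apply: filterS xy => t h _; rewrite -EFinM lee_fin -exprMn.
by rewrite ler_pXn2r // nnegrE ?mulr_ge0 ?normc_ge0.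
Qed.

Lemma L2_mul_bound f : exists M, 0 <= M /\
  forall x, L2_norm (L2_mul f x) <= M * L2_norm x.
Proof.
have [M fM] := Linfty_bounded f; exists `|M|; split=> // x.
apply: L2_norm_le_ae => //; apply: filterS2 (L2_mul_ae f x) fM => t -> h.
by rewrite normcM ler_wpM2r ?normc_ge0 // (le_trans h) ?ler_norm.
Qed.

Lemma inner_mul_real f x y : (forall t, complex.Im (f t) = 0) ->
  inner (L2_mul f x) y = inner x (L2_mul f y).
Proof.
move=> f0.
have sx := Linfty_mul_sqint f (L2_repr x); have sy := Linfty_mul_sqint f (L2_repr y).
rewrite (inner_ae sx (L2_sqint y) (L2_mul_ae f x) (aeW _ _)) //.
rewrite (inner_ae (L2_sqint x) sy (aeW _ _) (L2_mul_ae f y)) //.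
congr cint; apply/funext => t; rewrite conjcM.
have -> : (f t)^*%C = f t by have := f0 t; case: (f t) => a b /= ->; rewrite oppr0.
by rewrite mulrA [_ * f t]mulrC.
Qed.

Lemma inner_mul_ge0 f x : (forall t, 0 <= f t) -> 0 <= inner (L2_mul f x) x.
Proof.
move=> f0; have sx := Linfty_mul_sqint f (L2_repr x).
rewrite (inner_ae sx (L2_sqint x) (L2_mul_ae f x) (aeW _ _)) //.
have E t : 0 <= f t * x t * (x t)^*%C by rewrite -mulrA mulr_ge0 ?mulcJ_ge0.
rewrite /cint lecE /=; apply/andP; split.
  rewrite [X in Rintegral _ _ X](_ : _ = cst 0) ?Rintegral_cst ?mul0r //.
  by apply/funext => t; have := E t; rewrite lecE => /andP[/eqP].
by apply: Rintegral_ge0 => t _; have := E t; rewrite lecE => /andP[].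
Qed.

End multiplication.

(** * Toeplitz operators *)

Section toeplitz.
Context {R : realType}.
Local Notation sigma := (circle_measure R).
Implicit Types (x : L2 sigma) (g h : H2 R) (f : Linfty sigma).

Definition H2_inner g h : R[i] := inner (\val g) (\val h).

Lemma ip_norm_H2 : ip_norm H2_inner = @H2_norm R.
Proof. by apply/funext => g; rewrite /H2_norm -ip_norm_inner. Qed.

(** Completeness passes to the Hardy space because it is cut out by vanishing scalar
products, which survive limits. *)
Lemma H2_hilbert : hilbert H2_inner.
Proof.
have hL := @inner_hilbert _ _ _ sigma.
split.
- by move=> a x y z; rewrite /H2_inner linearP inner_linear.
- by move=> x y; exact: inner_conj.
- by move=> x; exact: (ip_ge0 hL).
- by move=> x /(ip_definite hL) x0; apply: val_inj; rewrite x0 raddf0.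
- move=> u cu.
  have [|x ux] := ip_complete hL (u := fun n => \val (u n)).
    move=> e /cu[n0 h]; exists n0 => m n n0n nm.
    by rewrite -raddfB; exact: h.
  have hx : x \in hardy.
    apply/hardyP => k; apply: (converges_ip0 hL ux); exists 0%N => n _.
    exact: (hardyP _).1 (valP (u n)) k.
  exists (exist _ x hx : H2 R) => e /ux[n0 h]; exists n0 => n n0n.
  rewrite ip_norm_H2 /H2_norm raddfB -ip_norm_inner; exact: h.
Qed.

Lemma H2_inner_ext g h : (forall k, H2_inner g k = H2_inner h k) -> g = h.
Proof.
move=> gh; apply/eqP; rewrite -subr_eq0; apply/eqP/(ip_definite H2_hilbert).
by rewrite (ipBl H2_hilbert) gh subrr.
Qed.

(** The projection removes the sum of the negative Fourier modes; its existence and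
the bound on the removed part both come from that series. *)
Lemma H2_proj_residual x :
  (forall g, inner (x - \val (H2_proj x)) (\val g) = 0) /\
  forall b, 0 <= b ->
    (forall n, \sum_(k < n) normc (inner x (neg_mode k)) ^+ 2 <= b ^+ 2) ->
    L2_norm (x - \val (H2_proj x)) <= b.
Proof.
have hL := @inner_hilbert _ _ _ sigma.
have [s [sx s0 sb]] := fourier_sum hL (@neg_mode_orthonormal R) x.
have hp : x - s \in hardy by apply/hardyP.
pose p : H2 R := exist _ (x - s) hp.
have pP g : inner (x - \val p) (\val g) = 0.
  by rewrite subKr; apply: s0 => k; exact: (hardyP _).1 (valP g) k.
have qP : forall g, inner (x - \val (H2_proj x)) (\val g) = 0.
  have pex : exists q : H2 R,
      [set q : H2 R | forall g : H2 R, inner (x - \val q) (\val g) = 0] q by exists p.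
  exact: (xgetPex 0 pex).
split=> // b b0 hb.
have -> : H2_proj x = p.
  apply: H2_inner_ext => k; have := pP k; rewrite -{1}(qP k) /H2_inner.
  by rewrite !(ipBl hL) => /addrI/oppr_inj ->.
by rewrite subKr -ip_norm_inner sb.
Qed.

Lemma inner_H2_proj x g : inner (\val (H2_proj x)) (\val g) = inner x (\val g).
Proof.
have [/(_ g) + _] := H2_proj_residual x.
by rewrite (ipBl (@inner_hilbert _ _ _ sigma)) => /eqP; rewrite subr_eq0 => /eqP.
Qed.

Lemma H2_proj_norm x : H2_norm (H2_proj x) <= L2_norm x.
Proof.
have [n0|n0] := eqVneq (H2_norm (H2_proj x)) 0; first by rewrite n0 L2_norm_ge0.
have np : 0 < H2_norm (H2_proj x) by rewrite lt_def n0 L2_norm_ge0.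
rewrite -(ler_pM2r np) -expr2.
have hL := @inner_hilbert _ _ _ sigma.
have := cauchy_schwarz hL x (\val (H2_proj x)).
rewrite !ip_norm_inner -inner_H2_proj inner_xx normc_real.
by rewrite ger0_norm ?sqr_ge0.
Qed.

Lemma toeplitz_inner f g h :
  H2_inner (toeplitz f g) h = inner (L2_mul f (\val g)) (\val h).
Proof. exact: inner_H2_proj. Qed.

Lemma toeplitzB f : {morph toeplitz f : g h / g - h}.
Proof.
move=> g h; apply: H2_inner_ext => k.
rewrite (ipBl H2_hilbert) !toeplitz_inner raddfB L2_mulB.
by rewrite (ipBl (@inner_hilbert _ _ _ sigma)).
Qed.

Lemma toeplitzZ f a g : toeplitz f (a *: g) = a *: toeplitz f g.
Proof.
apply: H2_inner_ext => k.
rewrite (ipZl H2_hilbert) !toeplitz_inner linearZ L2_mulZ.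
by rewrite (ipZl (@inner_hilbert _ _ _ sigma)).
Qed.

Lemma toeplitz_symmetric f g h : (forall t, complex.Im (f t) = 0) ->
  H2_inner (toeplitz f g) h = H2_inner g (toeplitz f h).
Proof.
move=> f0; rewrite (ip_conj H2_hilbert (toeplitz f h)) !toeplitz_inner.
by rewrite inner_mul_real // inner_conj.
Qed.

Lemma nonneg_toeplitz_positive f : (forall t, 0 <= f t) ->
  positive_op (@H2_norm R) (toeplitz f).
Proof.
move=> f0; have [M [M0 fM]] := L2_mul_bound f.
rewrite -ip_norm_H2; apply: (nonneg_form_positive_op H2_hilbert _ M0).
- exact: toeplitzB.
- by move=> g; rewrite ip_norm_H2; apply: le_trans (H2_proj_norm _) (fM _).
- by move=> g; rewrite toeplitz_inner inner_mul_ge0.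
Qed.

End toeplitz.

(** * Symbols with real values *)

Section symbols.
Context d (T : measurableType d) (R : realType) (mu : {measure set T -> \bar R}).

Lemma real_symbol_measurable (psi : T -> R) : measurable_fun setT psi ->
  measurable_fun setT (fun t => (psi t)%:C).
Proof. by move=> mpsi; apply/measurable_complexP; split. Qed.

Lemma real_symbol_bounded (psi : T -> R) (M : R) :
  {ae mu, forall t, `|psi t| <= M} ->
  exists M, {ae mu, forall t, normc (psi t)%:C <= M}.
Proof. by move=> psiM; exists M; apply: filterS psiM => t; rewrite normc_real. Qed.

Definition real_symbol (psi : T -> R) (M : R) (mpsi : measurable_fun setT psi)
    (psiM : {ae mu, forall t, `|psi t| <= M}) : Linfty mu :=
  MkLinfty (real_symbol_measurable mpsi) (real_symbol_bounded psiM).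

Lemma measurable_normc_le (g : T -> R[i]) (e : R) : 0 <= e ->
  measurable_fun setT g -> measurable [set t | normc (g t) <= e].
Proof.
move=> e0 /measurable_normc_sqr/measurable_EFinP mg.
rewrite (_ : [set t | _] = setT `&` (fun t => normc (g t) ^+ 2) @^-1` `]-oo, e ^+ 2]).
  by apply: mg => //; exact: measurable_itv.
by rewrite setTI; apply/seteqP; split => t /=; rewrite in_itv /= ler_pXn2r //
  nnegrE normc_ge0.
Qed.

Lemma L2_mul_ae_eq (f g : Linfty mu) : {ae mu, forall t, f t = g t} ->
  L2_mul f = L2_mul g.
Proof.
move=> fg; apply/funext => x; apply: L2_ext.
apply: filterS3 fg (L2_mul_ae f x) (L2_mul_ae g x) => t fg -> ->.
by rewrite fg.
Qed.

End symbols.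

(** * Almost null vectors of Toeplitz operators *)

Section essential.
Context {R : realType}.
Local Notation sigma := (circle_measure R).

Lemma toeplitz_ae_eq (f g : Linfty sigma) : {ae sigma, forall t, f t = g t} ->
  toeplitz f = toeplitz g.
Proof. by move=> /L2_mul_ae_eq fg; rewrite /toeplitz fg. Qed.

Lemma shift_toeplitz (f g : Linfty sigma) l : (forall t, g t = f t - l) ->
  shift_op (toeplitz f) l = toeplitz g.
Proof.
move=> gf; have hL := @inner_hilbert _ _ _ sigma.
apply/funext => x; apply: H2_inner_ext => k.
rewrite [RHS]toeplitz_inner /shift_op (ipBl H2_hilbert) (ipZl H2_hilbert).
transitivity (inner (L2_mul f (\val x) - l *: \val x) (\val k)).
  by rewrite (ipBl hL) (ipZl hL); congr (_ - _); exact: toeplitz_inner.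
congr (inner _ _); apply: L2_ext.
near=> t; rewrite (near (L2_sub_ae (L2_mul f (\val x)) (l *: \val x))) //.
rewrite (near (L2_mul_ae f (\val x))) // (near (L2_mul_ae g (\val x))) //.
by rewrite (near (L2_scale_ae l (\val x))) // gf mulrBl.
Unshelve. all: by end_near. Qed.

Section small_symbol.
Variables (f : Linfty sigma) (eps : R).
Hypothesis eps0 : 0 < eps.

Let E := [set t | normc (f t) <= eps].

Let mE : measurable E.
Proof.
exact: (measurable_normc_le (ltW eps0) (Linfty_measurable f)).
Qed.

Let ind_measurable : measurable_fun setT (fun t : circle R => (\1_E t : R)).
Proof. exact: measurable_indic. Qed.

Let ind_bounded : {ae sigma, forall t, `|(\1_E t : R)| <= 1}.
Proof. by apply: aeW => t; rewrite indicE; case: (_ \in _); rewrite ?normr0 ?normr1. Qed.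

Let ind : Linfty sigma := real_symbol ind_measurable ind_bounded.

(* The functions z ^ n restricted to E. Their products with f are small for every n,
   while they approach the Hardy space and tend weakly to zero as n grows. *)
Let window_sqint (n : nat) : (fun t => ind t * \val t ^+ n) \in sqint sigma :=
  Linfty_mul_sqint ind (sqint_of (sqint_zpow n)).

Let window n : L2 sigma := L2_class (sqint_of (window_sqint n)).

Let window_ae n : {ae sigma, forall t, window n t = ind t * \val t ^+ n}.
Proof. exact: (L2_classK (sqint_of (window_sqint n))). Qed.

Let window_norm n : L2_norm (window n) = L2_norm (window 0).
Proof.
have mw k := ((sqintP _ _).1 (window_sqint k)).1.
apply: (@pexpIrn _ 2) => //; rewrite ?nnegrE ?L2_norm_ge0 //.
apply: EFin_inj; rewrite -(L2_norm_integral_ae (mw n) (window_ae n)).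
rewrite -(L2_norm_integral_ae (mw 0%N) (window_ae 0)).
by apply: eq_integral => t _; rewrite !normcM !circle_normcX.
Qed.

Let window_norm_gt0 : sigma E != 0%E -> 0 < L2_norm (window 0).
Proof.
move=> E0; rewrite lt_def L2_norm_ge0 andbT; apply: contra E0 => /eqP w0.
have mw := ((sqintP _ _).1 (window_sqint 0)).1.
have ->: sigma E = (\int[sigma]_t (normc (ind t * \val t ^+ 0) ^+ 2)%:E)%E.
  rewrite -[E]setIT -integral_indic //; apply: eq_integral => t _.
  rewrite expr0 mulr1 normc_real indicE.
  by case: (_ \in _); rewrite ?normr0 ?normr1 ?expr0n ?expr1n.
by rewrite (L2_norm_integral_ae mw (window_ae 0)) w0 expr0n.
Qed.

Let window_mul_small n : L2_norm (L2_mul f (window n)) <= eps * L2_norm (window n).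
Proof.
apply: L2_norm_le_ae; first exact: ltW.
apply: filterS2 (L2_mul_ae f (window n)) (window_ae n) => t -> ->.
have -> : ind t = (t \in E)%:R%:C by rewrite -indicE.
have [|tE] := boolP (t \in E); last by rewrite mul0r mulr0 normc0 mulr0.
by rewrite inE /E /= => h; rewrite normcM ler_wpM2r ?normc_ge0.
Qed.

(* The negative modes of z ^ k 1_E are those of 1_E of order beyond k, hence a tail of
   a convergent series. *)
Let window_residual b : 0 < b -> exists k0, forall k, (k0 <= k)%N ->
  L2_norm (window k - \val (H2_proj (window k))) <= b.
Proof.
move=> b0; have hL := @inner_hilbert _ _ _ sigma.
have [k0 h] := qsum_cauchy hL (@neg_mode_orthonormal R) (window 0) (exprn_gt0 2 b0).
exists k0 => k kk; have [_] := H2_proj_residual (window k); apply; first exact: ltW.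
move=> n.
have shift j : inner (window k) (neg_mode j) = inner (window 0) (neg_mode (k + j)).
  rewrite (inner_ae (window_sqint k) (conj_pow_sqint j) (window_ae k) (neg_mode_ae j)).
  rewrite (inner_ae (window_sqint 0) (conj_pow_sqint (k + j))
    (window_ae 0) (neg_mode_ae (k + j))).
  congr cint; apply/funext => t; rewrite /conj_pow !conjcK expr0 mulr1.
  by rewrite -mulrA -exprD addnS.
apply: le_trans (h (k + n)%N k kk (leq_addr _ _)).
rewrite big_split_ord addrAC subrr add0r.
by rewrite le_eqVlt; apply/orP; left; apply/eqP; apply: eq_bigr => j _; rewrite shift.
Qed.

(* The scalar products with x are the conjugates of the negative Fourier
   coefficients of 1_E times the conjugate of x, shifted by one because the modes are
   numbered from z ^ (- 1). *)
Let window_weak (x : L2 sigma) b : 0 < b -> exists k0, forall k, (k0 <= k)%N ->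
  normc (inner x (window k)) <= b.
Proof.
move=> b0; have hL := @inner_hilbert _ _ _ sigma.
pose y0 := sqint_of (sqint_conjc (L2_sqint x)).
have sy := Linfty_mul_sqint ind y0.
pose y : L2 sigma := L2_class (sqint_of sy).
have yae : {ae sigma, forall t, y t = ind t * (x t)^*%C}.
  exact: (L2_classK (sqint_of sy)).
have [k0 h] := coef_small hL (@neg_mode_orthonormal R) y b0.
exists k0.+1 => -[//|k] kk; have := h k kk.
rewrite (inner_conj (window k.+1) x) normc_conj.
rewrite (inner_ae sy (conj_pow_sqint k) yae (neg_mode_ae k)).
rewrite (inner_ae (window_sqint k.+1) (L2_sqint x) (window_ae k.+1) (aeW _ _)) //.
suff -> : (fun t => ind t * \val y0 t * (conj_pow k t)^*%C) =
  (fun t => ind t * \val t ^+ k.+1 * (x t)^*%C) by [].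
by apply/funext => t; rewrite /conj_pow conjcK mulrAC.
Qed.

(** The vector is the projection of z ^ k 1_E for a large k, where E is the set on
which the symbol is small. *)
Lemma almost_null_vector n (v : 'I_n -> H2 R) (delta : R) : sigma E != 0%E ->
  0 < delta -> exists w : H2 R, [/\ 0 < H2_norm w,
    forall i, normc (H2_inner (v i) w) <= delta * H2_norm w &
    H2_norm (toeplitz f w) <= (2 * eps + delta) * H2_norm w].
Proof.
move=> E0 d0; have hL := @inner_hilbert _ _ _ sigma.
have r0 := window_norm_gt0 E0; set r := L2_norm (window 0) in r0.
have [M [M0 fM]] := L2_mul_bound f.
(* b bounds what the projection removes: at most half of the norm r, and so little
   that multiplication by f, of norm at most M, keeps it below delta r / 2. *)
pose b := Num.min (r / 2) (delta * r / (2 * (M + 1))).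
have M1 : 0 < M + 1 by lra.
have b0 : 0 < b.
  by rewrite lt_min !divr_gt0 ?mulr_gt0.
have br : b <= r / 2 by rewrite ge_min lexx.
have bM : M * b <= delta * r / 2.
  apply: (@le_trans _ _ ((M + 1) * b)); first by rewrite ler_wpM2r ?(ltW b0) //; lra.
  apply: (@le_trans _ _ ((M + 1) * (delta * r / (2 * (M + 1))))).
    by rewrite ler_pM2l // /b ge_min lexx orbT.
  by rewrite le_eqVlt; apply/orP; left; apply/eqP; field; rewrite gt_eqF.
have [k1 h1] := window_residual b0.
have weak i : exists k2, forall k, (k2 <= k)%N ->
    normc (inner (\val (v i)) (window k)) <= delta * r / 2.
  by apply: window_weak; rewrite divr_gt0 ?mulr_gt0.
have [k2 h2] := choice weak.
pose k := (k1 + \sum_i k2 i)%N.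
have rk := h1 k (leq_addr _ _).
set x := window k in rk; set w := H2_proj x in rk.
have rx : L2_norm x = r by exact: window_norm.
have wr : r / 2 <= H2_norm w.
  have : L2_norm x <= L2_norm (x - \val w) + L2_norm (\val w).
    by rewrite -!ip_norm_inner -[leLHS](congr1 _ (subrK (\val w) x)) ip_normD.
  by rewrite /H2_norm; lra.
exists w; split.
- by lra.
- move=> i; rewrite (ip_conj H2_hilbert) normc_conj /H2_inner inner_H2_proj.
  rewrite inner_conj normc_conj; apply: le_trans (h2 i k _) _.
    by rewrite /k (bigD1 i) //= addnCA leq_addr.
  by rewrite -mulrA ler_pM2l.
- apply: le_trans (H2_proj_norm _) _.
  have -> : L2_mul f (\val w) = L2_mul f x - L2_mul f (x - \val w).
    by rewrite L2_mulB subKr.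
  have tri : L2_norm (L2_mul f x - L2_mul f (x - \val w)) <=
      L2_norm (L2_mul f x) + L2_norm (L2_mul f (x - \val w)).
    by rewrite -!ip_norm_inner ip_normB.
  have h3 := window_mul_small k; rewrite -/x rx in h3.
  have h4 : L2_norm (L2_mul f (x - \val w)) <= M * b.
    by apply: le_trans (fM _) _; exact: ler_wpM2l.
  have h5 : delta * (r / 2) <= delta * H2_norm w by rewrite ler_pM2l.
  have h6 : eps * (r / 2) <= eps * H2_norm w by rewrite ler_pM2l.
  by lra.
Qed.

End small_symbol.

(** If zero is in the essential range of a real symbol, the symmetric operator has
almost null vectors almost orthogonal to any finite family, which is impossible for
a range of finite codimension. *)
Lemma toeplitz_infinite_codim (f : Linfty sigma) :
  (forall t, complex.Im (f t) = 0) ->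
  (forall eps, 0 < eps -> sigma [set t | normc (f t) <= eps] != 0%E) ->
  ~ finite_codim (range (toeplitz f)).
Proof.
move=> f0 fE fin.
have [n [v [eps [e0 h]]]] := finite_codim_bounded_below H2_hilbert
  (toeplitzZ f) (fun g h => toeplitz_symmetric g h f0) fin.
rewrite ip_norm_H2 in h.
have e3 : 0 < eps / 3 by rewrite divr_gt0.
have [w [w0 h1 h2]] := almost_null_vector e3 v (fE _ e3) e3.
have ew : eps / 3 * H2_norm w <= eps * H2_norm w by rewrite ler_pM2r //; lra.
have ew' : (2 * (eps / 3) + eps / 3) * H2_norm w <= eps * H2_norm w.
  by rewrite ler_pM2r //; lra.
have w00 : w = 0.
  by apply: h => [i|]; [exact: le_trans (h1 i) ew | exact: le_trans h2 ew'].
by move: w0; rewrite w00 -ip_norm_H2 (ip_norm0 H2_hilbert) ltxx.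
Qed.

End essential.

(** * The equivalence *)

Theorem proposition7 (R : realType) (f : Linfty (circle_measure R))
    (f_real : {ae circle_measure R, forall t, f t \is Num.real}) :
  (positive_op (@H2_norm R) (toeplitz f) <-> ess_positive_op (toeplitz f)) /\
  (ess_positive_op (toeplitz f) <-> {ae circle_measure R, forall t, 0 <= f t}).
Proof.
set sigma := circle_measure R.
pose phi t : R := complex.Re (f t).
have mphi : measurable_fun setT phi.
  by have /measurable_complexP[] := Linfty_measurable f.
have fphi : {ae sigma, forall t, f t = (phi t)%:C}.
  by apply: filterS f_real => t /RRe_real.
have [M fM] := Linfty_bounded f.
have phiM : {ae sigma, forall t, `|phi t| <= M}.
  by apply: filterS fM => t; apply: le_trans; exact: normc_ge_Re_norm.
have pos_ess : positive_op (@H2_norm R) (toeplitz f) -> ess_positive_op (toeplitz f).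
  exact: positive_op_ess_positive (toeplitzB f).
have ge0_pos : {ae sigma, forall t, 0 <= f t} ->
    positive_op (@H2_norm R) (toeplitz f).
  move=> f0.
  have mabs : measurable_fun setT (fun t => `|phi t|) by apply: measurableT_comp.
  have absM : {ae sigma, forall t, `| `|phi t| | <= M}.
    by apply: filterS phiM => t; rewrite normr_id.
  rewrite (@toeplitz_ae_eq _ f (real_symbol mabs absM)).
    by apply: nonneg_toeplitz_positive => t; rewrite ler0c.
  apply: filterS2 fphi f0 => t -> ; rewrite ler0c => h /=.
  by rewrite ger0_norm.
have ess_ge0 : ess_positive_op (toeplitz f) -> {ae sigma, forall t, 0 <= f t}.
  move=> ess; pose m := ess_inf sigma (EFin \o phi).
  (* Were the essential infimum m negative, it would be a negative point of the
     essential range of the symbol, hence of the essential spectrum. *)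
  suff : (0 <= m)%E.
    move=> /ess_infP; apply: filterS2 fphi => t -> /=.
    by rewrite lee_fin ler0c.
  rewrite leNgt; apply/negP => m0.
  have mM : ((- M)%:E <= m)%E.
    apply/ess_infP; apply: filterS phiM => t /=.
    by rewrite lee_fin ler_norml => /andP[].
  have [l ml] : exists l, m = l%:E.
    exists (fine m); rewrite fineK // fin_numElt (lt_le_trans _ mM) ?ltNyr //=.
    exact: lt_trans m0 (ltry _).
  have phil : {ae sigma, forall t, l <= phi t}.
    have := ess_inf_le sigma (EFin \o phi); rewrite -/m ml.
    by apply: filterS => t /=; rewrite lee_fin.
  have mg : measurable_fun setT (fun t => phi t - l).
    by apply: measurable_funB.
  have gM : {ae sigma, forall t, `|phi t - l| <= M + `|l|}.
    by apply: filterS phiM => t h; apply: le_trans (ler_normB _ _) _; rewrite lerD2r.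
  pose f' := real_symbol mphi phiM; pose g := real_symbol mg gM.
  have l0 : ~ (0 <= l%:C :> R[i]).
    by rewrite ler0c => h; move: m0; rewrite ml lte_fin ltNge h.
  apply: l0; apply: ess => -[_].
  rewrite (toeplitz_ae_eq (g := f') fphi) (@shift_toeplitz _ f' g); last first.
    by move=> t; rewrite /= rmorphB.
  apply: toeplitz_infinite_codim => // eps e0; apply/eqP => Eeps.
  have : ((l + eps)%:E <= m)%E.
    apply/ess_infP.
    have : {ae sigma, forall t, ~ normc (g t) <= eps}.
      exists [set t | normc (g t) <= eps]; split=> //.
        exact: (measurable_normc_le (ltW e0) (Linfty_measurable g)).
      by move=> t /= /contrapT.
    apply: filterS2 phil => t lt /negP; rewrite -ltNge normc_real ger0_norm ?subr_ge0 //.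
    by rewrite /= lee_fin; lra.
  by rewrite ml lee_fin; lra.
by split; split=> // h; [exact: ge0_pos (ess_ge0 h) | exact: pos_ess (ge0_pos h)].
Qed.
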